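(* An instance $((G,\lambda),F,k)$ of Temporal Transitive Completion, where $G=(V,E)$ and $F$ is a proper orientation of all of $E$, can be solved in $O(m^2)$ time, where $m=|E|$.
   Context: A temporal graph is $(G,\lambda)$ with $G=(V,E)$ finite simple undirected and $\lambda:E\to\mathbb{N}$. A proper orientation of $E$ contains exactly one of $uv$, $vu$ for each $\{u,v\}\in E$. A temporal supergraph of $(G,\lambda)$ is $(G',\lambda')$ with $G'=(V,E')$, $E\subseteq E'$, $\lambda'|_E=\lambda$. A proper orientation is temporally transitive if whenever $(uv,t_1),(vw,t_2)$ are oriented time-edges with $t_2\ge t_1$ there is an oriented time-edge $(uw,t_3)$ with $t_3\ge t_2$. Temporal Transitive Completion: given $(G,\lambda)$, a (partial) orientation $F$ and integer $k$, does there exist a temporal supergraph $(G',\lambda')$ with $|E'\setminus E|\le k$ and a temporally transitive orientation $F'\supseteq F$ of it? *)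

(* Defs.v *)
From HB Require Import structures.
From mathcomp Require Import all_boot all_order all_algebra.

Set Implicit Arguments.
Unset Strict Implicit.
Unset Printing Implicit Defensive.

Import Order.TTheory GRing.Theory Num.Theory.

(* Only the values of [lam] on the edges are meaningful. *)
Record tgraph (V : finType) := TGraph {
  edges : {set {set V}};
  lam : {set V} -> nat;
  edges_card2 : forall e, e \in edges -> #|e| = 2
}.

Definition tsupergraph (V : finType) (G G' : tgraph V) : Prop :=
  edges G \subset edges G' /\ {in edges G, forall e, lam G' e = lam G e}.

(* The ordered pair (u, v) is the edge {u, v} oriented from u to v. *)
Definition partial_orientation (V : finType) (E : {set {set V}})
    (F : {set V * V}) : Prop :=
  forall u v, (u, v) \in F -> [set u; v] \in E.

Definition proper_orientation (V : finType) (E : {set {set V}})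
    (F : {set V * V}) : Prop :=
  partial_orientation E F /\
  forall u v, [set u; v] \in E -> ((u, v) \in F) (+) ((v, u) \in F).

Definition temporally_transitive (V : finType) (G : tgraph V)
    (F : {set V * V}) : Prop :=
  forall u v w, (u, v) \in F -> (v, w) \in F ->
    lam G [set u; v] <= lam G [set v; w] ->
    (u, w) \in F /\ lam G [set v; w] <= lam G [set u; w].

Record ttc_instance (V : finType) := TTCInstance {
  ttc_graph : tgraph V;
  ttc_orient : {set V * V};
  ttc_budget : int;
  ttc_orientP : partial_orientation (edges ttc_graph) ttc_orient
}.

Definition TTC (V : finType) (I : ttc_instance V) : Prop :=
  exists (G' : tgraph V) (F' : {set V * V}),
    [/\ tsupergraph (ttc_graph I) G',
        (Posz #|edges G' :\: edges (ttc_graph I)| <= ttc_budget I)%R,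
        proper_orientation (edges G') F',
        ttc_orient I \subset F' &
        temporally_transitive G' F'].

(* Time is measured on the random access machine of Cook and Reckhow with the
   uniform cost criterion: a flat program, registers X_0, X_1, ... that hold
   integers, and a one-way read-only input tape.  Each instruction costs one
   unit; addition and subtraction are the only arithmetic operations. *)
Inductive instr :=
| IConst of nat & int         (* X_i := c *)
| IAdd of nat & nat & nat     (* X_i := X_j + X_k *)
| ISub of nat & nat & nat     (* X_i := X_j - X_k *)
| ILoad of nat & nat          (* X_i := X_(X_j) *)
| IStore of nat & nat         (* X_(X_i) := X_j *)
| IJumpPos of nat & nat       (* if X_i > 0 then goto l *)
| IRead of nat                (* X_i := next input word, 0 if there is none *)
| IHalt of bool.              (* stop; accept or reject *)

Definition program := seq instr.

Record config := Config {
  pc : nat;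
  mem : nat -> int;
  tape : seq int
}.

Definition upd (s : nat -> int) (i : nat) (x : int) : nat -> int :=
  fun j => if j == i then x else s j.

(* [None] when the machine is stuck: an indirect access at a negative address,
   or (in [run]) a program counter outside the program. *)
Definition step (i : instr) (c : config) : option (bool + config) :=
  let: Config l s w := c in
  match i with
  | IConst i x => Some (inr (Config l.+1 (upd s i x) w))
  | IAdd i j k => Some (inr (Config l.+1 (upd s i (s j + s k)%R) w))
  | ISub i j k => Some (inr (Config l.+1 (upd s i (s j - s k)%R) w))
  | ILoad i j =>
      if s j is Posz a then Some (inr (Config l.+1 (upd s i (s a)) w))
      else None
  | IStore i j =>
      if s i is Posz a then Some (inr (Config l.+1 (upd s a (s j)) w))
      else None
  | IJumpPos i l' =>
      Some (inr (Config (if (0 < s i)%R then l' else l.+1) s w))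
  | IRead i => Some (inr (Config l.+1 (upd s i (head 0%R w)) (behead w)))
  | IHalt b => Some (inl b)
  end.

(* [run p t c = Some b] iff [p], started in [c], halts with answer [b] after at
   most [t] steps. *)
Fixpoint run (p : program) (t : nat) (c : config) : option bool :=
  if t is t'.+1 then
    if onth p (pc c) is Some i then
      match step i c with
      | Some (inl b) => Some b
      | Some (inr c') => run p t' c'
      | None => None
      end
    else None
  else None.

Definition init (w : seq int) : config := Config 0 (fun=> 0%R) w.

Definition word_of (V : finType) (v : V) : int := Posz (enum_rank v).

(* The sizes |V|, |E|, |F| and the budget k, then a triple u, v, lambda(uv) for
   each edge {u, v}, then a pair u, v for each oriented pair uv of F.  The order
   of the two lists and of the two end points of an edge is arbitrary, so an
   instance has several encodings; in particular the edge triples carry no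
   information on F. *)
Definition encodes (V : finType) (I : ttc_instance V) (w : seq int) : Prop :=
  let G := ttc_graph I in
  exists (es fs : seq (V * V)),
    [/\ perm_eq [seq [set e.1; e.2] | e <- es] (enum (edges G)),
        perm_eq fs (enum (ttc_orient I)) &
        w = [:: Posz #|V|; Posz #|edges G|; Posz #|ttc_orient I|; ttc_budget I]
            ++ flatten [seq [:: word_of e.1; word_of e.2;
                                Posz (lam G [set e.1; e.2])] | e <- es]
            ++ flatten [seq [:: word_of f.1; word_of f.2] | f <- fs]].

Definition bigO (T f : nat -> nat) : Prop :=
  exists c m0 : nat, forall m, m0 <= m -> T m <= c * f m.

(* Main.v *)
(** An arc (x, w) is forced, with a label at least t, exactly when some walk
    from x to v uses arcs of label at most t only and is followed by an arc
    (v, w) of label t.  Hence a completion exists iff no forced arc is a loop or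
    has too small a label as an edge of G, and the number of forced pairs that
    are not edges is within the budget; the forced arcs, labelled with the
    largest t, then form a completion.

    For each arc (v, w) of label t, a backward search from v along arcs of label
    at most t finds the tails of the forced arcs in time O(m).  The machine
    cannot multiply, so the matrix of labels is addressed through row offsets
    k |V| handed out to the vertices at their first occurrence; registers start
    at 0, so neither the matrix nor the |V| vertex cells need initialising.
    The budget is set to 0 once a violation occurs. *)

Require Import Defs.
From mathcomp Require Import all_boot all_order all_algebra zify.

Set Implicit Arguments.
Unset Strict Implicit.
Unset Printing Implicit Defensive.

Import Order.TTheory GRing.Theory Num.Theory.

(** * Structured commands and their compilation *)

(** The time bound is in m alone, while |V| may be far larger. So nothing ever iterates over the
    vertices: every vertex handled is an end point of an edge, a search finds at most one vertex
    more than there are arcs, and stamping with the number of the current arc spares the clearing of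
    marks between searches. The forced pairs are ordered, whereas the budget counts edges. Both
    counts agree because two opposite arcs are never both forced, unless some forced arc is a loop;
    hence loops and small labels are the only violations to look for. A search is linear by an
    amortised argument: each arc lies in one list only, that of its head, and brings credits both
    for being scanned and for the later expansion of the vertex that it may discover. *)

Inductive cmd :=
| CSet of nat & int
| CAdd of nat & nat & nat
| CSub of nat & nat & nat
| CGet of nat & nat & nat
| CPut of nat & nat & nat
| CRead of nat
| CSkip
| CSeq of cmd & cmd
| CIf of nat & cmd & cmd
| CWhile of nat & cmd.

Record state := State {
  reg : nat -> int;
  arr : nat -> nat -> int;
  inp : seq int
}.

Definition setr (s : state) (r : nat) (x : int) : state :=
  State (fun j => if j == r then x else reg s j) (arr s) (inp s).

Definition seta (s : state) (k i : nat) (x : int) : state :=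
  State (reg s)
    (fun k' i' => if (k' == k) && (i' == i) then x else arr s k' i') (inp s).

(* Weakest precondition with time credits: [n] credits are available, each basic
   command and each test consumes one, and [Q] sees what is left.  So loops
   need no separate termination measure. *)
Fixpoint wp (c : cmd) (Q : nat -> state -> Prop) (n : nat) (s : state) : Prop :=
  match c with
  | CSkip => Q n s
  | CSeq c1 c2 => wp c1 (wp c2 Q) n s
  | _ =>
    if n is n'.+1 then
      match c with
      | CSet r x => Q n' (setr s r x)
      | CAdd r a b => Q n' (setr s r (reg s a + reg s b)%R)
      | CSub r a b => Q n' (setr s r (reg s a - reg s b)%R)
      | CGet r k a =>
          if reg s a is Posz i then Q n' (setr s r (arr s k i)) else False
      | CPut k a b =>
          if reg s a is Posz i then Q n' (seta s k i (reg s b)) else False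
      | CRead r =>
          Q n' (State (reg (setr s r (head 0%R (inp s)))) (arr s)
                  (behead (inp s)))
      | CIf r c1 c2 =>
          if (0 < reg s r)%R then wp c1 Q n' s else wp c2 Q n' s
      | CWhile r c1 =>
          exists I : nat -> state -> Prop, I n' s /\
            forall m s', I m s' ->
              if m is m'.+1 then
                if (0 < reg s' r)%R then wp c1 I m' s' else Q m' s'
              else False
      | _ => True
      end
    else False
  end.

Lemma wp_mono c Q Q' n s :
  (forall m s', Q m s' -> Q' m s') -> wp c Q n s -> wp c Q' n s.
Proof.
elim: c Q Q' n s => [r x|r a b|r a b|r k a|k a b|r||c1 IH1 c2 IH2|r c1 IH1 c2 IH2|r c IH]
  Q Q' [|n] s QQ' //=; try exact: QQ'; try by case: (reg s a) => // i; exact: QQ'.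
- by apply: IH1 => m s'; apply: IH2.
- by apply: IH1 => m s'; apply: IH2.
- by case: ifP => _; [apply: IH1 | apply: IH2].
- case=> I [I0 IS]; exists I; split=> // -[|m] s' /IS //.
  by case: ifP => _ //; apply: QQ'.
Qed.

(** Entering the loop costs one credit, whence [n.-1]; the invariant is then taken just before each
    test. That it implies [0 < m] reserves the credit for this test, which is why the invariants
    below end in a strict inequality. *)
Lemma wp_while (I : nat -> state -> Prop) r c (Q : nat -> state -> Prop) n s :
  I n.-1 s -> 0 < n ->
  (forall m s', I m s' -> 0 < m) ->
  (forall m s', I m.+1 s' -> (0 < reg s' r)%R -> wp c I m s') ->
  (forall m s', I m.+1 s' -> ~~ (0 < reg s' r)%R -> Q m s') ->
  wp (CWhile r c) Q n s.
Proof.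
case: n => // n /= I0 _ Ipos Ibody Iend; exists I; split=> // -[|m] s' Is.
  by have := Ipos _ _ Is.
by case: ifP => [|/negbT]; [exact: Ibody | exact: Iend].
Qed.

(** * Frame rule: what a command leaves unchanged *)

Fixpoint wregs (c : cmd) : seq nat :=
  match c with
  | CSet r _ | CAdd r _ _ | CSub r _ _ | CGet r _ _ | CRead r => [:: r]
  | CPut _ _ _ | CSkip => [::]
  | CSeq c1 c2 | CIf _ c1 c2 => wregs c1 ++ wregs c2
  | CWhile _ c => wregs c
  end.

Fixpoint warrs (c : cmd) : seq nat :=
  match c with
  | CPut k _ _ => [:: k]
  | CSeq c1 c2 | CIf _ c1 c2 => warrs c1 ++ warrs c2
  | CWhile _ c => warrs c
  | _ => [::]
  end.

Fixpoint wtape (c : cmd) : bool :=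
  match c with
  | CRead _ => true
  | CSeq c1 c2 | CIf _ c1 c2 => wtape c1 || wtape c2
  | CWhile _ c => wtape c
  | _ => false
  end.

Definition frame (c : cmd) (s s' : state) : Prop :=
  [/\ forall r, r \notin wregs c -> reg s' r = reg s r,
      forall k, k \notin warrs c -> arr s' k =1 arr s k
    & ~~ wtape c -> inp s' = inp s].

Lemma frame_refl c s : frame c s s.
Proof. by split. Qed.

Lemma frame_trans c s1 s2 s3 : frame c s1 s2 -> frame c s2 s3 -> frame c s1 s3.
Proof.
move=> [r1 a1 t1] [r2 a2 t2]; split=> [r nr|k nk i|nt].
- by rewrite r2 ?r1.
- by rewrite a2 ?a1.
- by rewrite t2 ?t1.
Qed.

Lemma frame_sub c c' s s' :
  {subset wregs c <= wregs c'} -> {subset warrs c <= warrs c'} ->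
  (wtape c -> wtape c') -> frame c s s' -> frame c' s s'.
Proof.
move=> rs ks ts [r1 a1 t1]; split=> [r nr|k nk|nt].
- by apply: r1; apply: contraNN nr; apply: rs.
- by apply: a1; apply: contraNN nk; apply: ks.
- by apply: t1; apply: contraNN nt.
Qed.

Lemma wp_frame c Q n s :
  wp c Q n s -> wp c (fun m s' => Q m s' /\ frame c s s') n s.
Proof.
have ncons (T : eqType) (x y : T) : x \notin [:: y] -> (x == y) = false.
  by rewrite inE => /negbTE.
elim: c Q n s => [r x|r a b|r a b|r k a|k a b|r||c1 IH1 c2 IH2|r c1 IH1 c2 IH2|r c IH]
  Q [|n] s //=.
- by split=> //; split=> //= j /ncons ->.
- by split=> //; split=> //= j /ncons ->.
- by split=> //; split=> //= j /ncons ->.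
- by case: (reg s a) => // i; split=> //; split=> //= j /ncons ->.
- by case: (reg s a) => // i; split=> //; split=> //= j /ncons -> i'.
- by split=> //; split=> //= j /ncons ->.
- move=> /IH1; apply: wp_mono => m s1 [/IH2 + f1].
  apply: wp_mono => m' s2 [Qs f2]; split=> //; apply: (@frame_trans _ _ s1).
    by apply: frame_sub f1 => /= [x|x|->] //; rewrite mem_cat => ->.
  by apply: frame_sub f2 => /= [x|x|->]; rewrite ?mem_cat ?orbT // => ->; rewrite orbT.
- move=> /IH1; apply: wp_mono => m s1 [/IH2 + f1].
  apply: wp_mono => m' s2 [Qs f2]; split=> //; apply: (@frame_trans _ _ s1).
    by apply: frame_sub f1 => /= [x|x|->] //; rewrite mem_cat => ->.
  by apply: frame_sub f2 => /= [x|x|->]; rewrite ?mem_cat ?orbT // => ->; rewrite orbT.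
- case: ifP => _; [move=> /IH1 | move=> /IH2]; apply: wp_mono => m s1 [Qs f1]; split=> //.
    by apply: frame_sub f1 => /= [x|x|->] //; rewrite mem_cat => ->.
  by apply: frame_sub f1 => /= [x|x|->]; rewrite ?mem_cat ?orbT // => ->; rewrite orbT.
- case=> I [I0 IS]; exists (fun m s' => I m s' /\ frame c s s'); split.
    by split=> //; apply: frame_refl.
  move=> [|m] s' [/IS + f1] //; case: ifP => // _ /IH.
  apply: wp_mono => m' s2 [Is2 f2]; split=> //; exact: frame_trans f1 f2.
Qed.

(** The frame relative to the state at loop entry holds at every iteration, so an invariant has to
    mention only what the body writes. *)
Lemma wp_while_frame (I : nat -> state -> Prop) r c (Q : nat -> state -> Prop) n s :
  I n.-1 s -> 0 < n ->
  (forall m s', I m s' -> 0 < m) ->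
  (forall m s', frame c s s' -> I m.+1 s' -> (0 < reg s' r)%R -> wp c I m s') ->
  (forall m s', frame c s s' -> I m.+1 s' -> ~~ (0 < reg s' r)%R -> Q m s') ->
  wp (CWhile r c) Q n s.
Proof.
move=> I0 n0 Ipos Ibody Iend.
apply: (@wp_while (fun m s' => I m s' /\ frame c s s')).
- by split=> //; apply: frame_refl.
- by [].
- by move=> m s' [Is _]; apply: Ipos Is.
- move=> m s' [Is fr] r0; apply: wp_mono (wp_frame (Ibody _ _ fr Is r0)) => m2 s2 [Is2 fr2].
  by split=> //; apply: frame_trans fr fr2.
- by move=> m s' [Is fr]; apply: Iend.
Qed.

(* Register r of the structured language lives at address 16 r and cell i of
   array k < 13 at address 16 i + k + 3; addresses 1 and 2 are scratch. *)
Definition index_code (k a : nat) : program :=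
  [:: IAdd 1 (16 * a) (16 * a); IAdd 1 1 1; IAdd 1 1 1; IAdd 1 1 1;
      IConst 2 (Posz (k + 3)); IAdd 1 1 2].

(** Jumps are absolute, so [l] is the address of the first instruction. [IConst 1 1] followed by
    [IJumpPos 1] is an unconditional jump. The else branch comes first because a test jumps on a
    positive value; a loop is entered at its test, which stands at the end. *)
Fixpoint compile (l : nat) (c : cmd) : program :=
  match c with
  | CSet r x => [:: IConst (16 * r) x]
  | CAdd r a b => [:: IAdd (16 * r) (16 * a) (16 * b)]
  | CSub r a b => [:: ISub (16 * r) (16 * a) (16 * b)]
  | CGet r k a => rcons (index_code k a) (ILoad (16 * r) 1)
  | CPut k a b => rcons (index_code k a) (IStore 1 (16 * b))
  | CRead r => [:: IRead (16 * r)]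
  | CSkip => [::]
  | CSeq c1 c2 =>
      let q := compile l c1 in q ++ compile (l + size q) c2
  | CIf r c1 c2 =>
      let q2 := compile l.+1 c2 in
      let l1 := l.+1 + size q2 + 2 in
      let q1 := compile l1 c1 in
      IJumpPos (16 * r) l1 :: q2 ++
        [:: IConst 1 1; IJumpPos 1 (l1 + size q1)] ++ q1
  | CWhile r c =>
      let q := compile l.+2 c in
      [:: IConst 1 1; IJumpPos 1 (l.+2 + size q)] ++ q ++
        [:: IJumpPos (16 * r) l.+2]
  end.

Fixpoint arrays_lt13 (c : cmd) : bool :=
  match c with
  | CGet _ k _ | CPut k _ _ => k < 13
  | CSeq c1 c2 | CIf _ c1 c2 => arrays_lt13 c1 && arrays_lt13 c2
  | CWhile _ c => arrays_lt13 c
  | _ => true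
  end.

(** * Correctness and cost of the compilation *)

Definition sim (s : state) (f : nat -> int) : Prop :=
  (forall r, f (16 * r) = reg s r) /\
  (forall k i, k < 13 -> f (16 * i + (k + 3)) = arr s k i).

(** Stated through [run] for every remaining time, not as an iterated [step], so that executions
    compose by rewriting. *)
Definition goes (p : program) (n : nat) (c c' : config) : Prop :=
  forall t, run p (n + t) c = run p t c'.

Lemma goes_trans p n1 n2 c1 c2 c3 :
  goes p n1 c1 c2 -> goes p n2 c2 c3 -> goes p (n1 + n2) c1 c3.
Proof. by move=> g1 g2 t; rewrite -addnA g1 g2. Qed.

Lemma runS p t c : run p t.+1 c =
  if onth p (pc c) is Some i then
    match step i c with
    | Some (inl b) => Some b
    | Some (inr c') => run p t c'
    | None => None
    end
  else None.
Proof. by []. Qed.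

Lemma goes_step p1 i p2 f w c' :
  step i (Config (size p1) f w) = Some (inr c') ->
  goes (p1 ++ i :: p2) 1 (Config (size p1) f w) c'.
Proof.
move=> st t; have onp : onth (p1 ++ i :: p2) (pc (Config (size p1) f w)) = Some i.
  by rewrite onthE map_cat nth_cat size_map ltnn subnn.
by rewrite add1n runS onp; cbv iota beta; rewrite st.
Qed.

(** The executed instruction moves into the prefix, so the program counter stays the size of the
    prefix. *)
Lemma goes_cons p1 i p2 f w g w' n c' :
  step i (Config (size p1) f w) = Some (inr (Config (size p1).+1 g w')) ->
  goes (rcons p1 i ++ p2) n (Config (size (rcons p1 i)) g w') c' ->
  goes (p1 ++ i :: p2) n.+1 (Config (size p1) f w) c'.
Proof.
by move=> st; rewrite cat_rcons size_rcons; apply: (goes_trans (goes_step p2 st)).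
Qed.

Lemma sim_setr s f r x : sim s f -> sim (setr s r x) (upd f (16 * r) x).
Proof.
case=> fr fa; split=> [j|k i lk]; rewrite /upd /=.
  by rewrite eqn_mul2l /= fr.
by rewrite -fa //; case: eqP => //; lia.
Qed.

Lemma sim_seta s f k i x :
  k < 13 -> sim s f -> sim (seta s k i x) (upd f (16 * i + (k + 3)) x).
Proof.
move=> lk [fr fa]; split=> [j|k' i' lk']; rewrite /upd /=.
  by rewrite -fr; case: eqP => //; lia.
rewrite -fa //; have [->|nk] /= := eqVneq k' k.
  by have [->|ni] := eqVneq i' i; rewrite ?eqxx //; case: eqP => //; lia.
by case: eqP => //; lia.
Qed.

Lemma sim_scratch s f j x : 0 < j < 3 -> sim s f -> sim s (upd f j x).
Proof.
move=> lj [fr fa]; split=> [r|k i lk]; rewrite /upd.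
  by rewrite -fr; case: eqP => //; lia.
by rewrite -fa //; case: eqP => //; lia.
Qed.

Lemma sim_inp s f w : sim s f -> sim (State (reg s) (arr s) w) f.
Proof. by case. Qed.

(** Four doublings replace the multiplication by 16. *)
Lemma index_code_goes s f k a i p1 p2 w :
  sim s f -> reg s a = Posz i ->
  exists2 g, sim s g /\ g 1 = Posz (16 * i + (k + 3)) &
    goes (p1 ++ index_code k a ++ p2) 6 (Config (size p1) f w)
      (Config (size p1 + 6) g w).
Proof.
move=> sf ra; have fra : f (16 * a) = Posz i by case: sf => ->.
pose g1 := upd f 1 (Posz (2 * i)); pose g2 := upd g1 1 (Posz (4 * i)).
pose g3 := upd g2 1 (Posz (8 * i)); pose g4 := upd g3 1 (Posz (16 * i)).
pose g5 := upd g4 2 (Posz (k + 3)); pose g6 := upd g5 1 (Posz (16 * i + (k + 3))).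
exists g6; first by split=> //; do 6 apply: sim_scratch => //.
have stepE j x y f' v : x = y ->
    Some (@inr bool config (Config v (upd f' j x) w)) = Some (inr (Config v (upd f' j y) w)).
  by move->.
apply: (@goes_cons _ _ _ _ _ g1); first by apply: stepE; rewrite fra; lia.
apply: (@goes_cons _ _ _ _ _ g2); first by apply: stepE; rewrite /g1 /upd /=; lia.
apply: (@goes_cons _ _ _ _ _ g3); first by apply: stepE; rewrite /g2 /upd /=; lia.
apply: (@goes_cons _ _ _ _ _ g4); first by apply: stepE; rewrite /g3 /upd /=; lia.
apply: (@goes_cons _ _ _ _ _ g5); first exact: stepE.
apply: (@goes_cons _ _ _ _ _ g6); first by apply: stepE; rewrite /g5 /g4 /upd /=; lia.
by rewrite !size_rcons (addnC (size p1)) => t.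
Qed.

(** A credit pays for 10 machine steps; the dearest command, an array access, takes 7: six for the
    address and one for the access. The code is placed between arbitrary [p1] and [p2] so that the
    induction applies to subcommands. *)
Lemma wp_goes c Q n s p1 p2 f :
  arrays_lt13 c -> wp c Q n s -> sim s f ->
  exists t n' s' f', [/\ t + 10 * n' <= 10 * n, Q n' s', sim s' f' &
    goes (p1 ++ compile (size p1) c ++ p2) t (Config (size p1) f (inp s))
      (Config (size p1 + size (compile (size p1) c)) f' (inp s'))].
Proof.
have basic i p1' p2' v g w g' w' :
    step i (Config (size p1') g w) = Some (inr (Config (size p1').+1 g' w')) ->
    v = (size p1').+1 ->
    goes (p1' ++ i :: p2') 1 (Config (size p1') g w) (Config v g' w').
  by move=> st ->; apply: goes_step.
elim: c Q n s p1 p2 f => [r x|r a b|r a b|r k a|k a b|r||c1 IH1 c2 IH2|r c1 IH1 c2 IH2|r c IH]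
  Q n s p1 p2 f ok.
- case: n => //= n Qs sf; exists 1, n, (setr s r x), (upd f (16 * r) x).
  by split; [lia | exact: Qs | exact: sim_setr | apply: basic; rewrite ?addn1].
- case: n => //= n Qs sf.
  exists 1, n, (setr s r (reg s a + reg s b)%R), (upd f (16 * r) (reg s a + reg s b)%R).
  split; [lia | exact: Qs | exact: sim_setr | apply: basic; rewrite ?addn1 //].
  by rewrite /= !sf.1.
- case: n => //= n Qs sf.
  exists 1, n, (setr s r (reg s a - reg s b)%R), (upd f (16 * r) (reg s a - reg s b)%R).
  split; [lia | exact: Qs | exact: sim_setr | apply: basic; rewrite ?addn1 //].
  by rewrite /= !sf.1.
- case: n => // n; rewrite [wp _ _ _ _]/=; case ra: (reg s a) => [i|//] Qs sf.
  have [g [sg g1] gg] := index_code_goes k p1 (ILoad (16 * r) 1 :: p2) (inp s) sf ra.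
  exists 7, n, (setr s r (arr s k i)), (upd g (16 * r) (arr s k i)).
  split; [lia | exact: Qs | exact: sim_setr | ].
  have -> : compile (size p1) (CGet r k a) = rcons (index_code k a) (ILoad (16 * r) 1) by [].
  rewrite cat_rcons size_rcons; apply: (goes_trans gg).
  have -> : size p1 + 6 = size (p1 ++ index_code k a) by rewrite size_cat.
  rewrite catA; apply: basic; last by rewrite size_cat addnS.
  by rewrite /= g1 sg.2.
- case: n => // n; rewrite [wp _ _ _ _]/=; case ra: (reg s a) => [i|//] Qs sf.
  have [g [sg g1] gg] := index_code_goes k p1 (IStore 1 (16 * b) :: p2) (inp s) sf ra.
  exists 7, n, (seta s k i (reg s b)), (upd g (16 * i + (k + 3)) (reg s b)).
  split; [lia | exact: Qs | exact: sim_seta | ].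
  have -> : compile (size p1) (CPut k a b) = rcons (index_code k a) (IStore 1 (16 * b)) by [].
  rewrite cat_rcons size_rcons; apply: (goes_trans gg).
  have -> : size p1 + 6 = size (p1 ++ index_code k a) by rewrite size_cat.
  rewrite catA; apply: basic; last by rewrite size_cat addnS.
  by rewrite /= g1 sg.1.
- case: n => //= n Qs sf; exists 1, n.
  exists (State (reg (setr s r (head 0%R (inp s)))) (arr s) (behead (inp s))).
  exists (upd f (16 * r) (head 0%R (inp s))).
  split; [lia | exact: Qs | | apply: basic; rewrite ?addn1 //].
  exact/sim_inp/sim_setr.
- by move=> Qs sf; exists 0, n, s, f; split=> //= t; rewrite addn0.
- move: ok => /= /andP[ok1 ok2] w1 sf.
  have [t1 [n1 [s1 [f1 [le1 w2 sf1 g1]]]]] :=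
    IH1 _ _ _ p1 (compile (size p1 + size (compile (size p1) c1)) c2 ++ p2) _ ok1 w1 sf.
  have [t2 [n2 [s2 [f2 [le2 Q2 sf2 g2]]]]] :=
    IH2 _ _ _ (p1 ++ compile (size p1) c1) p2 _ ok2 w2 sf1.
  exists (t1 + t2), n2, s2, f2; split=> //; first lia.
  move: g2; rewrite size_cat size_cat -!catA addnA => g2.
  exact: goes_trans g1 g2.
- move: ok => /= /andP[ok1 ok2].
  case: n => // n wr sf.
  set q2 := compile _ c2; set l1 := (_ + 2)%N; set q1 := compile l1 c1.
  set jmp := [:: IConst 1 1; IJumpPos 1 (l1 + size q1)].
  have jumped b : (0 < reg s r)%R = b ->
    goes (p1 ++ (IJumpPos (16 * r) l1 :: q2 ++ jmp ++ q1) ++ p2) 1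
      (Config (size p1) f (inp s)) (Config (if b then l1 else (size p1).+1) f (inp s)).
    by move=> b_eq; apply: goes_step; rewrite /= sf.1 b_eq.
  have -> : size p1 + (size (q2 ++ jmp ++ q1)).+1 = l1 + size q1.
    by rewrite !size_cat /= /l1; lia.
  case: ifP wr => [b_eq|b_eq] wr; have {}jumped := jumped _ b_eq.
    have l1E : l1 = size (p1 ++ IJumpPos (16 * r) l1 :: q2 ++ jmp).
      by rewrite size_cat /= size_cat /= /l1; lia.
    have [t1 [n1 [s1 [f1 [le1 Q1 sf1 g1]]]]] :=
      IH1 _ _ _ (p1 ++ IJumpPos (16 * r) l1 :: q2 ++ jmp) p2 _ ok1 wr sf.
    exists (1 + t1), n1, s1, f1; split=> //; first lia.
    apply: (goes_trans jumped); move: g1; rewrite -l1E -/q1.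
    by rewrite -!catA /= -!catA.
  have p1E : (size p1).+1 = size (rcons p1 (IJumpPos (16 * r) l1)) by rewrite size_rcons.
  have [t1 [n1 [s1 [f1 [le1 Q1 sf1 g1]]]]] :=
    IH2 _ _ _ (rcons p1 (IJumpPos (16 * r) l1)) ((jmp ++ q1) ++ p2) _ ok2 wr sf.
  exists (1 + (t1 + 2)), n1, s1, (upd f1 1 (Posz 1)); split=> //; first lia.
    exact: sim_scratch.
  apply: (goes_trans jumped); rewrite /= -cat_rcons -catA.
  rewrite -p1E -/q2 in g1; apply: (goes_trans g1); rewrite catA.
  have -> : (size p1).+1 + size q2 = size (rcons p1 (IJumpPos (16 * r) l1) ++ q2).
    by rewrite size_cat size_rcons.
  apply: goes_cons; first reflexivity.
  exact: goes_step.
- move: ok => /= ok; case: n => // n [I [I0 IS]] sf.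
  set q := compile _ c.
  set pre := [:: IConst 1 1; IJumpPos 1 ((size p1).+2 + size q)].
  have preE : size (p1 ++ pre) = (size p1).+2 by rewrite size_cat addn2.
  have codeE : p1 ++ (pre ++ q ++ [:: IJumpPos (16 * r) (size p1).+2]) ++ p2 =
      ((p1 ++ pre) ++ q) ++ IJumpPos (16 * r) (size p1).+2 :: p2.
    by rewrite -!catA.
  have loop m s1 f1 : I m s1 -> sim s1 f1 ->
    exists t n' s' f', [/\ t + 10 * n' <= 10 * m, Q n' s', sim s' f' &
      goes (p1 ++ (pre ++ q ++ [:: IJumpPos (16 * r) (size p1).+2]) ++ p2) t
        (Config ((size p1).+2 + size q) f1 (inp s1))
        (Config ((size p1).+2 + size q).+1 f' (inp s'))].
    (* Every test consumes a credit, so the credits serve as the termination measure. *)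
    elim/ltn_ind: m s1 f1 => m IHm s1 f1 /IS; case: m IHm => // m IHm + sf1.
    have tst b : (0 < reg s1 r)%R = b ->
      goes (p1 ++ (pre ++ q ++ [:: IJumpPos (16 * r) (size p1).+2]) ++ p2) 1
        (Config ((size p1).+2 + size q) f1 (inp s1))
        (Config (if b then (size p1).+2 else ((size p1).+2 + size q).+1) f1 (inp s1)).
      move=> b_eq; rewrite codeE.
      have -> : (size p1).+2 + size q = size ((p1 ++ pre) ++ q) by rewrite size_cat preE.
      by apply: goes_step; rewrite /= sf1.1 b_eq.
    case: ifP => b_eq; have {}tst := tst _ b_eq; last first.
      by move=> Qm; exists 1, m, s1, f1; split=> //; lia.
    move=> wm.
    have [t2 [n2 [s2 [f2 [le2 I2 sf2 g2]]]]] :=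
      IH _ _ _ (p1 ++ pre) (IJumpPos (16 * r) (size p1).+2 :: p2) _ ok wm sf1.
    have lt_n2 : n2 < m.+1 by lia.
    have [t3 [n3 [s3 [f3 [le3 Q3 sf3 g3]]]]] := IHm _ lt_n2 _ _ I2 sf2.
    exists (1 + (t2 + t3)), n3, s3, f3; split=> //; first lia.
    apply: (goes_trans tst); apply: goes_trans g3.
    by move: g2; rewrite preE codeE -/q catA.
  have [t1 [n1 [s1 [f1 [le1 Q1 sf1 g1]]]]] := loop _ _ _ I0 (sim_scratch (j := 1) (Posz 1) isT sf).
  exists (1 + (1 + t1)), n1, s1, f1; split=> //; first lia.
  have -> : size p1 + size (pre ++ q ++ [:: IJumpPos (16 * r) (size p1).+2]) =
      ((size p1).+2 + size q).+1.
    by rewrite !size_cat /=; lia.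
  apply: goes_trans; first exact: goes_step.
  apply: goes_trans; last exact: g1.
  rewrite /= -cat_rcons -(size_rcons p1 (IConst 1 1)).
  exact: goes_step.
Qed.

Lemma run_mono p t t' c b : t <= t' -> run p t c = Some b -> run p t' c = Some b.
Proof.
elim: t t' c => // t IH [//|t'] c le_t /=.
case: (onth p (pc c)) => // i; case: (step i c) => // -[//|c']; exact: IH.
Qed.

Definition decider (c : cmd) (r : nat) : program :=
  let q := compile 0 c in q ++ [:: IJumpPos (16 * r) (size q).+2; IHalt false; IHalt true].

(** The two extra steps are the final jump and the halt. *)
Lemma wp_decider c r n w (P : Prop) : arrays_lt13 c ->
  wp c (fun _ s => (0 < reg s r)%R <-> P) n (State (fun=> 0%R) (fun _ _ => 0%R) w) ->
  exists b : bool, run (decider c r) (10 * n + 2) (init w) = Some b /\ (b <-> P).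
Proof.
move=> ok wc; have [] := @wp_goes _ _ _ _ [::]
  [:: IJumpPos (16 * r) (size (compile 0 c)).+2; IHalt false; IHalt true]
  (fun=> 0%R) ok wc.
  by split.
move=> t [n' [s [f [le_t Qs sf g]]]]; exists (0 < reg s r)%R; split=> //.
apply: (@run_mono _ (t + 2)); first lia.
rewrite (g 2) add0n -/(compile 0 c); set q := compile 0 c.
have onq i : onth (q ++ [:: IJumpPos (16 * r) (size q).+2; IHalt false; IHalt true]) (size q + i) =
   onth [:: IJumpPos (16 * r) (size q).+2; IHalt false; IHalt true] i.
  by rewrite !onthE map_cat nth_cat size_map ltnNge leq_addr /= addKn.
have := onq 0; have := onq 1; have := onq 2; rewrite addn0 addn1 addn2 => onq2 onq1 onq0.
move: {onq g} onq0 onq1 onq2; rewrite /decider -/q.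
move: (q ++ _) => code onq0 onq1 onq2.
rewrite runS [pc _]/= onq0 [onth _ 0]/=; cbv iota beta; rewrite [step _ _]/= sf.1.
cbv iota beta; rewrite runS; case: (0 < reg s r)%R; by rewrite [pc _]/= ?onq1 ?onq2.
Qed.

(** * Rules for symbolic execution *)

Lemma wp_seqE c1 c2 Q n s : wp (CSeq c1 c2) Q n s = wp c1 (wp c2 Q) n s.
Proof. by []. Qed.
Lemma wp_skipE Q n s : wp CSkip Q n s = Q n s.
Proof. by []. Qed.
Lemma wp_setE r x Q n s : wp (CSet r x) Q n.+1 s = Q n (setr s r x).
Proof. by []. Qed.
Lemma wp_addE r a b Q n s :
  wp (CAdd r a b) Q n.+1 s = Q n (setr s r (reg s a + reg s b)%R).
Proof. by []. Qed.
Lemma wp_subE r a b Q n s :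
  wp (CSub r a b) Q n.+1 s = Q n (setr s r (reg s a - reg s b)%R).
Proof. by []. Qed.
Lemma wp_getI r k a i Q n s : reg s a = Posz i ->
  Q n (setr s r (arr s k i)) -> wp (CGet r k a) Q n.+1 s.
Proof. by rewrite /= => ->. Qed.
Lemma wp_putI k a b i Q n s : reg s a = Posz i ->
  Q n (seta s k i (reg s b)) -> wp (CPut k a b) Q n.+1 s.
Proof. by rewrite /= => ->. Qed.
Lemma wp_readE r Q n s :
  wp (CRead r) Q n.+1 s =
    Q n (State (reg (setr s r (head 0%R (inp s)))) (arr s) (behead (inp s))).
Proof. by []. Qed.
Lemma wp_ifI r c1 c2 Q n s :
  ((0 < reg s r)%R -> wp c1 Q n s) -> (~~ (0 < reg s r)%R -> wp c2 Q n s) ->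
  wp (CIf r c1 c2) Q n.+1 s.
Proof. by rewrite /=; case: ifP => _ H1 H2; [apply: H1 | apply: H2]. Qed.
Arguments wp : simpl never.

(* Matches syntactically: rewriting up to conversion would unfold the named
   commands. *)
Ltac wstep :=
  lazymatch goal with
  | |- wp (CSeq ?c ?d) ?Q ?n ?s => rewrite (wp_seqE c d Q n s)
  | |- wp CSkip ?Q ?n ?s => rewrite (wp_skipE Q n s)
  | |- wp (CSet ?r ?x) ?Q (S ?n) ?s => rewrite (wp_setE r x Q n s)
  | |- wp (CAdd ?r ?a ?b) ?Q (S ?n) ?s => rewrite (wp_addE r a b Q n s)
  | |- wp (CSub ?r ?a ?b) ?Q (S ?n) ?s => rewrite (wp_subE r a b Q n s)
  | |- wp (CRead ?r) ?Q (S ?n) ?s => rewrite (wp_readE r Q n s)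
  end.
Ltac wsteps := repeat (wstep; simpl).
(* Runs through the next array access; [t] must bring the address to the form [Posz i], which also
   shows that it is not negative. *)
Tactic Notation "wmem" tactic3(t) :=
  wsteps; (eapply wp_getI || eapply wp_putI); [simpl; t; reflexivity | simpl; wsteps].

(** * Forced arcs *)

Section Closure.

Variables (V : finType) (G : tgraph V) (F : {set V * V}).

Let E := edges G.

Hypothesis FP : proper_orientation E F.

Definition upto (t : nat) : rel V :=
  fun x y => ((x, y) \in F) && (lam G [set x; y] <= t).

Definition reaches (x : V) (f : V * V) : bool :=
  connect (upto (lam G [set f.1; f.2])) x f.1.

Definition violates (x : V) (f : V * V) : bool :=
  (x == f.2) || ([set x; f.2] \in edges G) &&
                (lam G [set x; f.2] < lam G [set f.1; f.2]).

Definition closure_pairs : {set V * V} :=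
  [set p | [exists f in F, (f.2 == p.2) && reaches p.1 f]].

Definition new_pairs : {set V * V} :=
  [set p in closure_pairs | [set p.1; p.2] \notin edges G].

Definition consistent : Prop :=
  forall x f, f \in F -> reaches x f -> ~~ violates x f.

Lemma closure_pairsP x w :
  reflect (exists2 v, (v, w) \in F & reaches x (v, w)) ((x, w) \in closure_pairs).
Proof.
rewrite inE; apply: (iffP exists_inP) => [[[v w'] fF /= /andP[/eqP <-]]|[v vF xv]].
  by exists v.
by exists (v, w); rewrite //= eqxx.
Qed.

Lemma orientation_edge u v : (u, v) \in F -> [set u; v] \in E.
Proof. exact: FP.1. Qed.

Lemma sub_closure u v : (u, v) \in F -> (u, v) \in closure_pairs.
Proof. by move=> uv; apply/closure_pairsP; exists u; rewrite // /reaches connect0. Qed.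

Lemma upto_trans t t' x y : t <= t' -> connect (upto t) x y -> connect (upto t') x y.
Proof.
move=> le_t; apply: connect_sub => u v /andP[uv luv]; apply: connect1.
by rewrite /upto uv (leq_trans luv).
Qed.

(* An arc [(v, w)] preceded by any walk on labels at most its own forces an arc
   from the start of the walk: contract the last two arcs repeatedly. *)
Lemma forced_arc (G' : tgraph V) (F' : {set V * V}) x v w :
  tsupergraph G G' -> F \subset F' -> temporally_transitive G' F' ->
  (v, w) \in F -> reaches x (v, w) ->
  (x, w) \in F' /\ lam G [set v; w] <= lam G' [set x; w].
Proof.
move=> [_ lamE] /subsetP FF' tt vw /connectP[p xp vE].
rewrite /= in xp vE; elim: p x xp vE => [|y p IH] x /=.
  by move=> _ <-; rewrite FF' // lamE // orientation_edge.
move=> /andP[/andP[xy lxy] yp] vE.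
have [yw lw] := IH _ yp vE.
have [|xw lxw] := tt x y w (FF' _ xy) yw.
  by rewrite lamE ?orientation_edge // (leq_trans lxy).
by split=> //; apply: leq_trans lxw.
Qed.

Lemma set2_inj (a b c d : V) :
  [set a; b] = [set c; d] -> (a, b) = (c, d) \/ (a, b) = (d, c).
Proof.
move=> eqS.
have: a \in [set c; d] by rewrite -eqS set21.
have: b \in [set c; d] by rewrite -eqS set22.
have: c \in [set a; b] by rewrite eqS set21.
have: d \in [set a; b] by rewrite eqS set22.
rewrite !inE => H1 H2 H3 H4; case/orP: H1 => /eqP H1; case/orP: H2 => /eqP H2;
  case/orP: H3 => /eqP H3; case/orP: H4 => /eqP H4.
all: (by left; congruence) || (by right; congruence).
Qed.

Lemma asym_completion (G' : tgraph V) (F' : {set V * V}) u v :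
  proper_orientation (edges G') F' -> (u, v) \in F' -> (v, u) \notin F'.
Proof. by move=> [E' /(_ u v) P] uv; have := P (E' _ _ uv); rewrite uv. Qed.

Lemma completion_consistent (G' : tgraph V) (F' : {set V * V}) :
  tsupergraph G G' -> proper_orientation (edges G') F' -> F \subset F' ->
  temporally_transitive G' F' -> consistent.
Proof.
move=> GG' FP' FF' tt x [v w] vw xv; have [xw lxw] := forced_arc GG' FF' tt vw xv.
rewrite /violates negb_or /=; apply/andP; split.
  by apply/eqP=> xE; have := edges_card2 (FP'.1 _ _ xw); rewrite xE setUid cards1.
by rewrite negb_and -leqNgt -implybE; apply/implyP=> xwE; rewrite (GG'.2 _ xwE) in lxw.
Qed.

(** All new pairs lie in [F'], which contains no two opposite pairs, so distinct new pairs span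
    distinct edges. *)
Lemma completion_card (G' : tgraph V) (F' : {set V * V}) :
  tsupergraph G G' -> proper_orientation (edges G') F' -> F \subset F' ->
  temporally_transitive G' F' -> #|new_pairs| <= #|edges G' :\: E|.
Proof.
move=> GG' FP' FF' tt.
have newF' p : p \in new_pairs -> p \in F'.
  case: p => x w; rewrite inE => /andP[/closure_pairsP[v vw xv] _].
  by have [] := forced_arc GG' FF' tt vw xv.
rewrite -(card_in_imset (f := fun p => [set p.1; p.2])) => [|p q /newF' pF /newF' qF].
  apply/subset_leq_card/subsetP => e /imsetP[[x w] xw ->].
  move: (xw); rewrite inE => /andP[_ xwE]; rewrite inE xwE /=.
  exact/FP'.1/newF'.
case: p q pF qF => [a b] [c d] pF qF /set2_inj[-> //|eqp].
by move: pF; rewrite eqp (negbTE (asym_completion FP' qF)).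
Qed.

Hypothesis cons : consistent.

(** The arc [(y, w)] joins the two walks; the inequality lets the first walk and this arc pass under
    the bound of [f]. *)
Lemma reaches_cat x y w f : (y, w) \in F -> reaches x (y, w) ->
  reaches w f -> lam G [set y; w] <= lam G [set f.1; f.2] -> reaches x f.
Proof.
move=> yw xy wf le_l; apply: connect_trans wf; apply: (@connect_trans _ _ y).
  exact: upto_trans le_l xy.
by apply: connect1; rewrite /upto yw.
Qed.

(** The walks of two opposite forced pairs close up to a cycle through both last arcs [(v, w)] and
    [(y, x)]. The one with the larger label bounds the whole cycle and so forces a loop at its
    head. *)
Lemma closure_asym x w : (x, w) \in closure_pairs -> (w, x) \notin closure_pairs.
Proof.
move=> /closure_pairsP[v vw xv]; apply/negP => /closure_pairsP[y yx wy].
have [le_l|/ltnW le_l] := leqP (lam G [set v; w]) (lam G [set y; x]).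
  by have := cons yx (reaches_cat vw xv wy le_l); rewrite /violates eqxx.
by have := cons vw (reaches_cat yx wy xv le_l); rewrite /violates eqxx.
Qed.

Definition closure_edges : {set {set V}} :=
  E :|: [set [set p.1; p.2] | p in closure_pairs].

(** Labels belong to unordered edges, so the maximum ranges over both orientations of [e]; by
    [closure_asym] only one of them can contribute. *)
Definition closure_lam (e : {set V}) : nat :=
  \max_(f in F | [exists x, (e == [set x; f.2]) && reaches x f]) lam G [set f.1; f.2].

Lemma closure_edges_card2 e : e \in closure_edges -> #|e| = 2.
Proof.
rewrite inE => /orP[/edges_card2 //|/imsetP[[x w] xw ->]] /=; rewrite cards2.
by case: eqVneq xw => // -> ww; have := closure_asym ww; rewrite ww.
Qed.

Definition closure_graph := TGraph closure_lam closure_edges_card2.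

Lemma mem_closure_edges x w : [set x; w] \in closure_edges ->
  (x, w) \in closure_pairs \/ (w, x) \in closure_pairs.
Proof.
rewrite inE => /orP[xwE|/imsetP[[a b] ab /set2_inj[|]] [-> ->]]; auto.
have := FP.2 _ _ xwE; case xw: (_ \in F); case wx: (_ \in F) => // _.
  by left; apply: sub_closure.
by right; apply: sub_closure.
Qed.

Lemma closure_lam_ge x f : f \in F -> reaches x f ->
  lam G [set f.1; f.2] <= closure_lam [set x; f.2].
Proof.
move=> fF xf; apply: (leq_bigmax_cond (F := fun f => lam G [set f.1; f.2])).
by rewrite fF; apply/existsP; exists x; rewrite eqxx.
Qed.

(** Consistency bounds every label forced on [e] from above; conversely the arc of [e] forces
    itself, by the empty walk. *)
Lemma closure_lam_edge e : e \in E -> closure_lam e = lam G e.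
Proof.
move=> eE; apply/eqP; rewrite eqn_leq; apply/andP; split.
  apply/bigmax_leqP => f /andP[fF /existsP[x /andP[/eqP ex xf]]].
  have := cons fF xf; rewrite /violates negb_or negb_and -ex -/E eE /=.
  by rewrite -leqNgt => /andP[].
have /eqP/cards2P[u [v [uv eE2]]] := edges_card2 eE; subst e.
have := FP.2 _ _ eE; case Fuv: ((u, v) \in F) => /=.
  by move=> _; apply: (@closure_lam_ge u (u, v)); rewrite // /reaches connect0.
case Fvu: ((v, u) \in F) => //= _; rewrite setUC.
by apply: (@closure_lam_ge v (v, u)); rewrite // /reaches connect0.
Qed.

(** The maximum is over a nonempty family, and [closure_asym] excludes that it is attained by an arc
    forcing [(w, v)]. *)
Lemma closure_lam_attained v w : (v, w) \in closure_pairs ->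
  exists y, [/\ (y, w) \in F, reaches v (y, w)
    & closure_lam [set v; w] = lam G [set y; w]].
Proof.
move=> vw; have /closure_pairsP[y yw vy] := vw.
have : 0 < #|[pred f in F | [exists x, ([set v; w] == [set x; f.2]) && reaches x f]]|.
  apply/card_gt0P; exists (y, w); rewrite inE yw.
  by apply/existsP; exists v; rewrite eqxx.
move=> /(eq_bigmax_cond (fun f => lam G [set f.1; f.2])) [[a b]].
rewrite inE => /andP[ab /existsP[x /andP[/eqP/set2_inj eq_vw xab]]] lE.
case: eq_vw => -[? ?]; subst; first by exists a.
by have := closure_asym vw; rewrite (_ : _ \in _) //; apply/closure_pairsP; exists a.
Qed.

(** Let [(y, v)] and [(z, w)] attain the labels of [uv] and [vw]. The order of these labels allows
    the walk from [u] through [(y, v)] to continue to [z] under the bound of [(z, w)], so that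
    [(z, w)] forces [(u, w)] with at least its own label. *)
Lemma closure_transitive : temporally_transitive closure_graph closure_pairs.
Proof.
move=> u v w uv vw /=.
have [y [yv uy ->]] := closure_lam_attained uv.
have [z [zw vz ->]] := closure_lam_attained vw => le_l.
have uz := reaches_cat yv uy vz le_l.
split; first by apply/closure_pairsP; exists z.
exact: (closure_lam_ge zw uz).
Qed.

Lemma closure_proper : proper_orientation closure_edges closure_pairs.
Proof.
split=> u v.
  by move=> uv; rewrite inE; apply/orP; right; apply/imsetP; exists (u, v).
by case/mem_closure_edges => uv; rewrite uv (negbTE (closure_asym uv)).
Qed.

Lemma closure_supergraph : tsupergraph G closure_graph.
Proof. by split; [apply: subsetUl | move=> e; apply: closure_lam_edge]. Qed.

Lemma card_closure_edges : #|closure_edges :\: E| <= #|new_pairs|.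
Proof.
rewrite setDUl setDv set0U.
apply: leq_trans (leq_imset_card (fun p => [set p.1; p.2]) (mem new_pairs)).
apply/subset_leq_card/subsetP => e; rewrite inE => /andP[eE /imsetP[p pC eP]].
by apply/imsetP; exists p; rewrite // inE pC -eP.
Qed.

End Closure.

(** The number of new pairs bounds every completion from below, and the closure does not exceed
    it. *)
Lemma TTC_iff (V : finType) (I : ttc_instance V) :
  let G := ttc_graph I in let F := ttc_orient I in
  proper_orientation (edges G) F ->
  TTC I <-> consistent G F /\ (Posz #|new_pairs G F| <= ttc_budget I)%R.
Proof.
move=> G F FP; split.
  move=> [G' [F' [GG' le_k FP' FF' tt]]]; split.
    exact: completion_consistent FP _ _ GG' FP' FF' tt.
  by apply: le_trans le_k; rewrite lez_nat (completion_card FP GG' FP' FF' tt).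
move=> [cons le_k]; exists (closure_graph cons), (closure_pairs G F); split.
- exact: closure_supergraph.
- by apply: le_trans le_k; rewrite lez_nat card_closure_edges.
- exact: closure_proper.
- by apply/subsetP => -[u v]; apply: sub_closure.
- exact: closure_transitive.
Qed.

(** * The program *)

#[local] Notation "c ;; d" := (CSeq c d) (at level 60, right associativity).

(* rK holds the remaining budget plus 1, rS a label plus 1, rO the last row
   offset handed out, rJ the number of the current arc, which is also the stamp
   of its search, and rP a pointer into a list of arcs with the same head.
   A cell of aMat holds the label plus 1 of an edge, -1 for a forced pair that
   is already counted, and 0 otherwise. *)
#[local] Notation rN := 0 (only parsing).
#[local] Notation rM := 1 (only parsing).
#[local] Notation rF := 2 (only parsing).
#[local] Notation rK := 3 (only parsing).
#[local] Notation rOne := 4 (only parsing).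
#[local] Notation rA := 5 (only parsing).
#[local] Notation rB := 6 (only parsing).
#[local] Notation rS := 7 (only parsing).
#[local] Notation rX := 8 (only parsing).
#[local] Notation rY := 9 (only parsing).
#[local] Notation rZ := 10 (only parsing).
#[local] Notation rO := 11 (only parsing).
#[local] Notation rI := 12 (only parsing).
#[local] Notation rJ := 13 (only parsing).
#[local] Notation rH := 14 (only parsing).
#[local] Notation rC := 15 (only parsing).
#[local] Notation rL := 16 (only parsing).
#[local] Notation rP := 17 (only parsing).
#[local] Notation aOff := 0 (only parsing).
#[local] Notation aMat := 1 (only parsing).
#[local] Notation aTail := 2 (only parsing).
#[local] Notation aHead := 3 (only parsing).
#[local] Notation aLab := 4 (only parsing).
#[local] Notation aNext := 5 (only parsing).
#[local] Notation aFirst := 6 (only parsing).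
#[local] Notation aMark := 7 (only parsing).
#[local] Notation aQueue := 8 (only parsing).

(** The first offset handed out is |V|, so offset 0 means that the vertex has no row yet. *)
Definition touch (a : nat) : cmd :=
  CGet rX aOff a;;
  CIf rX CSkip (CAdd rO rO rN;; CPut aOff a rO).

(** The orientation is unknown while the edges are read, so the label is stored for both orders of
    the end points. *)
Definition store_label : cmd :=
  CGet rX aOff rA;; CAdd rX rX rB;; CPut aMat rX rS;;
  CGet rX aOff rB;; CAdd rX rX rA;; CPut aMat rX rS;;
  CSub rM rM rOne.

Definition read_edge : cmd :=
  CRead rA;; CRead rB;; CRead rS;; CAdd rS rS rOne;;
  touch rA;; touch rB;; store_label.

Definition read_edges : cmd := CWhile rM read_edge.

(** An arc comes without its label, which is looked up in the matrix. The arc is then prepended to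
    the list of arcs with the same head, as needed for a backward search. *)
Definition read_arc : cmd :=
  CAdd rI rI rOne;; CRead rA;; CRead rB;;
  CGet rX aOff rA;; CAdd rX rX rB;; CGet rS aMat rX;;
  CPut aTail rI rA;; CPut aHead rI rB;; CPut aLab rI rS;;
  CGet rX aFirst rB;; CPut aNext rI rX;; CPut aFirst rB rI;;
  CSub rF rF rOne.

Definition read_arcs : cmd := CWhile rF read_arc.

(** Only positivity can be tested, so [a <= b] becomes [b - a + 1 > 0]. A mark below the current
    stamp stems from an earlier search and counts as absent. *)
Definition scan_arc : cmd :=
  CGet rY aTail rP;; CGet rZ aLab rP;; CSub rZ rS rZ;; CAdd rZ rZ rOne;;
  CIf rZ
    (CGet rZ aMark rY;; CSub rZ rJ rZ;;
     CIf rZ (CPut aMark rY rJ;; CPut aQueue rC rY;; CAdd rC rC rOne) CSkip)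
    CSkip;;
  CGet rP aNext rP.

Definition scan : cmd := CWhile rP scan_arc.

Definition expand : cmd :=
  CGet rX aQueue rH;; CAdd rH rH rOne;; CGet rP aFirst rX;;
  scan;; CSub rL rC rH.

(** [rH] and [rC] delimit the waiting part of the queue and [rL] is its length. Cells are never
    released, so the first [rC] of them finally list all vertices found, for use by [visits]. *)
Definition search : cmd :=
  CPut aMark rA rJ;; CSet rH 0;; CPut aQueue rH rA;;
  CAdd rC rH rOne;; CAdd rL rH rOne;;
  CWhile rL expand.

(** Once [rK] is set to 0 it never becomes positive again, so a violation is final. In the else
    branch [rZ + 1 > 0] separates the value 0 from the mark -1. *)
Definition visit_cell : cmd :=
  CGet rY aOff rX;; CAdd rY rY rB;; CGet rZ aMat rY;;
  CIf rZ
    (CSub rZ rS rZ;; CIf rZ (CSet rK 0) CSkip)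
    (CAdd rZ rZ rOne;;
     CIf rZ (CSet rZ (- 1)%R;; CPut aMat rY rZ;; CSub rK rK rOne) CSkip).

(** A loop is recognised by neither difference of the two end points being positive. *)
Definition visit : cmd :=
  CSub rC rC rOne;; CGet rX aQueue rC;;
  CSub rY rX rB;; CSub rZ rB rX;;
  CIf rY CSkip (CIf rZ CSkip (CSet rK 0));; visit_cell.

Definition visits : cmd := CWhile rC visit.

Definition process_arc : cmd :=
  CAdd rJ rJ rOne;;
  CGet rA aTail rJ;; CGet rB aHead rJ;; CGet rS aLab rJ;;
  search;; visits;; CSub rI rI rOne.

Definition process_arcs : cmd := CWhile rI process_arc.

Definition ttc_cmd : cmd :=
  CRead rN;; CRead rM;; CRead rF;; CRead rK;;
  CSet rOne 1;; CAdd rK rK rOne;;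
  read_edges;; read_arcs;; process_arcs.

Lemma wp_use c P Q n s :
  wp c P n s -> (forall m s', P m s' -> frame c s s' -> Q m s') -> wp c Q n s.
Proof. by move=> /wp_frame wc PQ; apply: wp_mono wc => m s' []; apply: PQ. Qed.

(** * Reading the input: rows, edges and arcs *)

Section VertexNumbering.

Variables (V : finType) (I : ttc_instance V).

Let G := ttc_graph I.
Let F := ttc_orient I.

Definition num (v : V) : nat := enum_rank v.

Lemma num_inj : injective num.
Proof. by move=> u v /ord_inj/enum_rank_inj. Qed.

Lemma num_lt v : num v < #|V|.
Proof. exact: ltn_ord. Qed.

Definition label (es : seq (V * V)) (u w : V) : nat :=
  if [set u; w] \in [seq [set e.1; e.2] | e <- es] then (lam G [set u; w]).+1
  else 0.

(* Row [q u] of the matrix, numbered from 1, belongs to the [u] in [D]. *)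
Record edge_inv (D : seq V) (es : seq (V * V)) (q : V -> nat) (cnt : nat)
    (s : state) : Prop := EdgeInv {
  edge_inv_N : reg s rN = Posz #|V|;
  edge_inv_O : reg s rO = Posz (#|V| * cnt);
  edge_inv_off : forall v, arr s aOff (num v) = Posz (#|V| * q v);
  edge_inv_le : forall v, q v <= cnt;
  edge_inv_gt0 : forall v, (0 < q v) = (v \in D);
  edge_inv_inj : forall u v, u \in D -> q u = q v -> u = v;
  edge_inv_mat : forall u w, u \in D ->
    arr s aMat (#|V| * q u + num w) = Posz (label es u w);
  edge_inv_fresh : forall x, #|V| * cnt.+1 <= x -> arr s aMat x = 0%R;
  edge_inv_sub : {in es, forall e, e.1 \in D /\ e.2 \in D}
}.

Lemma label_notin (es : seq (V * V)) (D : seq V) u w :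
  (forall e, e \in es -> e.1 \in D /\ e.2 \in D) ->
  u \notin D -> label es u w = 0.
Proof.
move=> esD uD; rewrite /label; case: ifP => // /mapP[e /esD[e1 e2] eq_e].
by move: (set21 u w); rewrite eq_e !inE => /orP[] /eqP uE; move: uD; rewrite uE ?e1 ?e2.
Qed.

Lemma touch_ok (a : nat) v D es q cnt k s : a != rX -> a != rO ->
  edge_inv D es q cnt s -> reg s a = Posz (num v) ->
  wp (touch a) (fun m s' => k <= m /\
    exists q' cnt', edge_inv (v :: D) es q' cnt' s') k.+4 s.
Proof.
move=> /negbTE aX /negbTE aO [N O off le_q gt0 inj mat fresh sub] av.
rewrite /touch; wmem (rewrite av).
have V0 : 0 < #|V| by apply: leq_trans (num_lt v).
have sub' e : e \in es -> e.1 \in v :: D /\ e.2 \in v :: D.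
  by move=> /sub[e1 e2]; rewrite !inE e1 e2 !orbT.
apply: wp_ifI => /=; rewrite off ltz_nat muln_gt0 V0 gt0 /= => vD; wsteps.
  have DE u : (u \in v :: D) = (u \in D).
    by rewrite inE; case: eqVneq => // ->; rewrite vD.
  split; first lia.
  by exists q, cnt; split=> //= [u|u w|u w]; rewrite DE; [exact: gt0|exact: inj|exact: mat].
have qv0 : q v = 0 by apply/eqP; rewrite -leqn0 leqNgt gt0.
wmem (rewrite aO aX av); split; first lia.
exists (fun u => if u == v then cnt.+1 else q u), cnt.+1; split=> //=.
- by rewrite O N -PoszD mulnS addnC.
- move=> u; rewrite (inj_eq num_inj); case: eqVneq => // _.
  by rewrite O N -PoszD mulnS addnC.
- by move=> u; case: eqP => // _; apply: leqW.
- by move=> u; rewrite inE; case: eqP => //= _.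
- move=> u w; rewrite !inE; case: eqVneq => [-> _|uv /= uD].
    by case: eqVneq => [->|_ wq] //; have := le_q w; rewrite -wq ltnn.
  by case: eqVneq => [->|_]; [move=> uq; have := le_q u; rewrite uq ltnn | exact: inj].
(* The new row is still zero, as are the labels at [v], which is an end point of no edge read so
   far. *)
- move=> u w; rewrite inE; case: eqVneq => [-> _|uv /= uD]; last exact: mat.
  by rewrite fresh ?leq_addr // (label_notin _ sub).
- by move=> x le_x; apply: fresh; apply: leq_trans le_x; rewrite leq_mul2l leqW ?orbT.
Qed.

End VertexNumbering.

(** Exposes [n] successors, on which the rules of [wstep] match. *)
Lemma credits n m : n <= m -> exists2 m', m = n + m' & m = iter n succn m'.
Proof.
move=> le_nm; exists (m - n); rewrite ?subnKC // -[LHS](subnKC le_nm).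
by elim: n {le_nm} (m - n) => [|n IH] j //=; rewrite addSn IH.
Qed.

Lemma cell_inj n a b x y : x < n -> y < n -> n * a + x = n * b + y -> a = b /\ x = y.
Proof.
move=> lx ly eq_c; have n0 : 0 < n by lia.
rewrite !(mulnC n) in eq_c.
have := congr1 (divn^~ n) eq_c; have := congr1 (modn^~ n) eq_c.
by rewrite /= !modnMDl !modn_small // !divnMDl // !divn_small // !addn0.
Qed.

Lemma row_neq n a b i x : a <= b -> i < n -> n * b.+1 <= x -> (x == n * a + i) = false.
Proof.
by move=> /(leq_mul (leqnn n)); rewrite mulnS => le_ab lt_i le_x; apply/eqP; lia.
Qed.

Section EdgeReading.

Variables (V : finType) (I : ttc_instance V).

Let G := ttc_graph I.
Let F := ttc_orient I.

Definition edge_words (es : seq (V * V)) : seq int :=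
  flatten [seq [:: Posz (num e.1); Posz (num e.2); Posz (lam G [set e.1; e.2])] | e <- es].

Lemma label_rcons es (e : V * V) u w :
  label I (rcons es e) u w =
    if [set u; w] == [set e.1; e.2] then (lam G [set u; w]).+1 else label I es u w.
Proof. by rewrite /label map_rcons mem_rcons inE; case: eqP. Qed.

(** An iteration takes at most 20 credits: 1 for the test, 4 for reading, 4 for each [touch] and 7
    for storing. Here and below, [k] is left for the rest of the program. *)
Lemma read_edges_ok es tl k s :
  reg s rN = Posz #|V| -> reg s rM = Posz (size es) -> reg s rOne = Posz 1 ->
  reg s rO = 0%R -> inp s = edge_words es ++ tl ->
  (forall x, arr s aOff x = 0%R) -> (forall x, arr s aMat x = 0%R) ->
  wp read_edges (fun m s' => [/\ k <= m, inp s' = tl &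
      exists D q cnt, edge_inv I D es q cnt s'])
    (k + 30 * size es + 2) s.
Proof.
move=> N M One O inpE off0 mat0.
apply: (@wp_while (fun m s' => exists done rest D q cnt,
  [/\ es = done ++ rest, edge_inv I D done q cnt s', inp s' = edge_words rest ++ tl,
      reg s' rM = Posz (size rest) /\ reg s' rOne = Posz 1 & k + 30 * size rest < m])).
- exists [::], es, [::], (fun=> 0), 0; split=> //; last lia.
  split=> //; first by rewrite O muln0.
  by move=> v; rewrite off0 muln0.
- lia.
- by move=> m s' [done [rest [D [q [cnt [_ _ _ _ lt_m]]]]]]; lia.
- move=> m {s N M One O inpE off0 mat0}s.
  move=> [done [[|e rest] [D [q [cnt [esE inv inpE [M One] lt_m]]]]]].
    by rewrite M.
  move=> _; have [|m1 m1E ->] := @credits 8 m; first by move: lt_m => /=; lia.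
  rewrite /read_edge /=; wsteps; rewrite inpE /= One.
  set s0 := setr _ _ _.
  have inv0 : edge_inv I D done q cnt s0 by case: inv; split.
  apply: (wp_use (@touch_ok V I rA e.1 D done q cnt m1 s0 isT isT inv0 erefl)) => m2 s2 [le_m2].
  move=> [q2 [cnt2 inv2]] [fr2 fa2 ft2].
  have [|m3 m3E ->] := @credits 4 m2; first by move: lt_m => /=; lia.
  have s2B : reg s2 rB = Posz (num e.2) by rewrite fr2.
  wstep; apply: (wp_use (@touch_ok V I rB e.2 _ done q2 cnt2 m3 s2 isT isT inv2 s2B)).
  move=> m4 s4 [le_m4] [q4 [cnt4 inv4]] [fr4 fa4 ft4].
  have [|m5 m5E ->] := @credits 7 m4; first by move: lt_m => /=; lia.
  have rE r : r \in [:: rA; rB; rS; rM; rOne; rN] -> reg s4 r = reg s0 r.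
    rewrite !inE => rP; have [? ?] : (r == rX) = false /\ (r == rO) = false.
      by move: rP; do !case/orP; move=> /eqP ->.
    by rewrite fr4 ?fr2 // !inE; apply/norP; split; apply/negbT.
  have A4 : reg s4 rA = Posz (num e.1) by rewrite rE.
  have B4 : reg s4 rB = Posz (num e.2) by rewrite rE.
  have S4 : reg s4 rS = Posz (lam G [set e.1; e.2]).+1 by rewrite rE //= -PoszD addn1.
  have off4 := edge_inv_off inv4.
  rewrite /store_label.
  wmem (rewrite A4); wmem (rewrite off4 B4 -PoszD); wmem (rewrite B4).
  wmem (rewrite off4 A4 -PoszD); rewrite S4 (rE rM) // (rE rOne) //=.
  have e1D : e.1 \in [:: e.2, e.1 & D] by rewrite !inE eqxx orbT.
  have e2D : e.2 \in [:: e.2, e.1 & D] by rewrite !inE eqxx.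
  exists (rcons done e), rest, [:: e.2, e.1 & D], q4, cnt4; split=> /=.
  + by rewrite esE cat_rcons.
  + case: inv4 => N4 O4 _ le4 gt4 inj4 mat4 fresh4 sub4; split=> //=.
    * move=> u w uD; rewrite label_rcons.
      have cellE x y : (#|V| * q4 u + num w == #|V| * q4 x + num y) = (u == x) && (w == y).
        apply/eqP/andP => [eq_c|[/eqP -> /eqP ->]] //.
        have [/(inj4 _ _ uD) -> /num_inj ->] := cell_inj (num_lt w) (num_lt y) eq_c.
        by rewrite !eqxx.
      rewrite !cellE mat4 //; case: ([set u; w] =P [set e.1; e.2]) => [/set2_inj[] [-> ->]|ne].
      - by rewrite !eqxx ?orbT /=; case: ifP.
      - by rewrite !eqxx /= setUC.
      case: andP => [[/eqP uE /eqP wE]|_]; first by case: ne; rewrite uE wE setUC.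
      by case: andP => [[/eqP uE /eqP wE]|_] //; case: ne; rewrite uE wE.
    * move=> x le_x.
      have lt_cell (u v : V) : (x == #|V| * q4 u + num v) = false.
        exact: row_neq (le4 u) (num_lt v) le_x.
      by rewrite !lt_cell // fresh4.
    * move=> e'; rewrite mem_rcons inE => /orP[/eqP -> //|]; exact: sub4.
  + by rewrite ft4 // ft2.
  + split=> //; rewrite M /=; lia.
  + by move: lt_m => /=; lia.
- move=> m s' [done [[|e rest] [D [q [cnt [esE inv {}inpE [{}M {}One] lt_m]]]]]]; last by rewrite M.
  move=> _; split=> //; first by move: lt_m => /=; lia.
  by exists D, q, cnt; rewrite esE cats0.
Qed.

End EdgeReading.

Section ArcReading.

Variables (V : finType) (I : ttc_instance V).

Let G := ttc_graph I.
Let F := ttc_orient I.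

Definition arc_words (fs : seq (V * V)) : seq int :=
  flatten [seq [:: Posz (num f.1); Posz (num f.2)] | f <- fs].

(* Arcs are numbered from 1 in reading order, whereas [l] has the last arc
   first: the number of [f] in [p ++ f :: l] is [(size l).+1].  The number 0
   ends a linked list. *)
Fixpoint last_into (x : V) (l : seq (V * V)) : nat :=
  if l is f :: l' then if f.2 == x then size l else last_into x l' else 0.

Lemma last_into_eq0 x l f : last_into x l = 0 -> f \in l -> f.2 != x.
Proof.
elim: l => //= g l IH; rewrite inE; case: eqVneq => // gx /IH fl /orP[/eqP ->|] //.
Qed.

Lemma last_into_gt0 x l : 0 < last_into x l ->
  exists p f q, [/\ l = p ++ f :: q, f.2 = x, last_into x l = (size q).+1
                  & forall g, g \in p -> g.2 != x].
Proof.
elim: l => //= g l IH; case: eqVneq => [gx _|gx /IH[p [f [q [-> fx lE pP]]]]].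
  by exists [::], g, l.
exists (g :: p), f, q; split=> // h; rewrite inE => /orP[/eqP -> //|]; exact: pP.
Qed.

Record arc_inv (l : seq (V * V)) (s : state) : Prop := ArcInv {
  arc_inv_first : forall v, arr s aFirst (num v) = Posz (last_into v l);
  arc_inv_tail : forall p f q, l = p ++ f :: q ->
    arr s aTail (size q).+1 = Posz (num f.1);
  arc_inv_head : forall p f q, l = p ++ f :: q ->
    arr s aHead (size q).+1 = Posz (num f.2);
  arc_inv_lab : forall p f q, l = p ++ f :: q ->
    arr s aLab (size q).+1 = Posz (lam G [set f.1; f.2]).+1;
  arc_inv_next : forall p f q, l = p ++ f :: q ->
    arr s aNext (size q).+1 = Posz (last_into f.2 q)
}.

Lemma arc_inv_frame c l s s' : frame c s s' ->
  all (fun k => k \notin warrs c) [:: aFirst; aTail; aHead; aLab; aNext] ->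
  arc_inv l s -> arc_inv l s'.
Proof.
move=> [_ fa _] /and5P[k1 k2 k3 k4 /andP[k5 _]] [first tail head lab next].
by split=> *; rewrite fa //; eauto.
Qed.

Lemma read_arcs_ok (off : V -> nat) fs tl k s :
  reg s rF = Posz (size fs) -> reg s rOne = Posz 1 -> reg s rI = Posz 0 ->
  inp s = arc_words fs ++ tl -> (forall x, arr s aFirst x = Posz 0) ->
  (forall v, arr s aOff (num v) = Posz (off v)) ->
  {in fs, forall f, arr s aMat (off f.1 + num f.2) = Posz (lam G [set f.1; f.2]).+1} ->
  wp read_arcs (fun m s' => [/\ k <= m, reg s' rI = Posz (size fs)
      & arc_inv (rev fs) s'])
    (k + 20 * size fs + 2) s.
Proof.
move=> Fc One I0 inpE first0 offE matE.
apply: (@wp_while_frame (fun m s' => exists done rest,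
  [/\ fs = done ++ rest, inp s' = arc_words rest ++ tl,
      reg s' rF = Posz (size rest) /\ reg s' rI = Posz (size done),
      arc_inv (rev done) s' & k + 20 * size rest < m])).
- exists [::], fs; split=> //; last lia.
  by split=> [v|[]|[]|[]|[]]; rewrite ?first0.
- lia.
- by move=> m s' [done [rest [_ _ _ _ lt_m]]]; lia.
- move=> m s1 [fr fa _] [done [[|f rest] [fsE inp1 [F1 I1] inv lt_m]]].
    by rewrite F1.
  move=> _; have [|m1 m1E ->] := @credits 13 m; first by move: lt_m => /=; lia.
  rewrite /read_arc /=; wsteps; rewrite inp1 /=.
  have One1 : reg s1 rOne = Posz 1 by rewrite fr.
  have off1 v : arr s1 aOff (num v) = Posz (off v) by rewrite fa.
  have mat1 : arr s1 aMat (off f.1 + num f.2) = Posz (lam G [set f.1; f.2]).+1.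
    by rewrite fa // matE // fsE mem_cat inE eqxx orbT.
  wmem idtac; wmem (rewrite off1 -PoszD); wmem (rewrite I1 One1 -PoszD).
  wmem (rewrite I1 One1 -PoszD); wmem (rewrite I1 One1 -PoszD); wmem idtac.
  wmem (rewrite I1 One1 -PoszD); wmem idtac.
  rewrite I1 One1 -PoszD (arc_inv_first inv) off1 mat1 addn1.
  exists (rcons done f), rest; split=> /=.
  + by rewrite fsE cat_rcons.
  + by [].
  + by split; [rewrite F1 /=; lia | rewrite size_rcons].
  + case: inv => first tail head lab next; rewrite rev_rcons.
    have szE : size (rev done) = size done by rewrite size_rev.
    have ltq p g q : rev done = p ++ g :: q -> ((size q).+1 == (size done).+1) = false.
      by move=> dE; rewrite -szE dE size_cat /=; lia.
    split=> /=.
    * move=> v; rewrite (inj_eq (@num_inj V)) size_rev (eq_sym f.2).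
      case: (v =P f.2) => // _; exact: first.
    * move=> [|g p] h q [-> dE]; first by rewrite -dE szE eqxx.
      by rewrite (ltq _ _ _ dE) (tail _ _ _ dE).
    * move=> [|g p] h q [-> dE]; first by rewrite -dE szE eqxx.
      by rewrite (ltq _ _ _ dE) (head _ _ _ dE).
    * move=> [|g p] h q [-> dE]; first by rewrite -dE szE eqxx.
      by rewrite (ltq _ _ _ dE) (lab _ _ _ dE).
    * move=> [|g p] h q [-> dE]; first by rewrite -dE szE eqxx.
      by rewrite (ltq _ _ _ dE) (next _ _ _ dE).
  + by move: lt_m => /=; lia.
- move=> m s' _ [done [[|f rest] [fsE _ [F1 I1] inv lt_m]]]; last by rewrite F1.
  move=> _; rewrite cats0 in fsE; rewrite fsE; split=> //; move: lt_m => /=; lia.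
Qed.

End ArcReading.

(** * Backward search *)

Section Search.

Variables (V : finType) (I : ttc_instance V).

Let G := ttc_graph I.
Let F := ttc_orient I.

Definition enters (x : V) : pred (V * V) := fun g => g.2 == x.

Definition enters_none (D : seq V) : pred (V * V) := fun g => g.2 \notin D.

(** The potential of the search counts the arcs into vertices not yet expanded: expanding [x]
    releases exactly its incoming arcs, so each arc is paid for once. *)
Lemma count_enters_none D x l : x \notin D ->
  count (enters_none D) l = count (enters x) l + count (enters_none (rcons D x)) l.
Proof.
move=> xD; elim: l => //= g l ->; rewrite /enters /enters_none mem_rcons inE.
by case: eqVneq => [->|_] /=; rewrite ?xD; lia.
Qed.

Definition arc_lam (f : V * V) : nat := lam G [set f.1; f.2].

Record queue_inv (f : V * V) (j : nat) (D : seq V) (s : state) : Prop := QueueInv {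
  queue_inv_uniq : uniq D;
  queue_inv_cell : forall A x B, D = A ++ x :: B ->
    arr s aQueue (size A) = Posz (num x);
  queue_inv_in : forall x, x \in D -> arr s aMark (num x) = Posz j;
  queue_inv_notin : forall x, x \notin D -> (arr s aMark (num x) < Posz j)%R;
  queue_inv_C : reg s rC = Posz (size D);
  queue_inv_reach : {in D, forall x, reaches G F x f};
  queue_inv_start : f.1 \in D
}.

Lemma queue_inv_ext f j D s s' :
  arr s' aQueue =1 arr s aQueue -> arr s' aMark =1 arr s aMark ->
  reg s' rC = reg s rC -> queue_inv f j D s -> queue_inv f j D s'.
Proof.
move=> eqQ eqM eqC [uD cell mark nmark CE reachD start].
by split=> // [A x B|x|x|]; rewrite ?eqQ ?eqM ?eqC //; eauto.
Qed.

(** Each of the 25 credits per arc has a purpose up to slack: at most 13 for scanning it, test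
    included, and 10 handed on in the postcondition for expanding the vertex that it may add to the
    queue. *)
Lemma scan_ok (f : V * V) (l : seq (V * V)) j D x k s :
  {subset l <= F} -> arc_inv I l s -> reg s rS = Posz (arc_lam f).+1 ->
  reg s rJ = Posz j -> reg s rOne = Posz 1 -> reaches G F x f ->
  queue_inv f j D s -> reg s rP = Posz (last_into x l) ->
  wp scan (fun m s' => exists N, [/\ queue_inv f j (D ++ N) s',
      {in l, forall g, g.2 = x -> arc_lam g <= arc_lam f -> g.1 \in D ++ N}
      & k + 10 * size N <= m])
    (k + 25 * count (enters x) l + 2) s.
Proof.
move=> lF inv S J One xf qD P.
apply: (@wp_while_frame (fun m s' => exists N p q,
  [/\ l = p ++ q, queue_inv f j (D ++ N) s', reg s' rP = Posz (last_into x q),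
      {in p, forall g, g.2 = x -> arc_lam g <= arc_lam f -> g.1 \in D ++ N}
      & k + 10 * size N + 25 * count (enters x) q < m])).
- by exists [::], [::], l; rewrite cats0; split=> //=; lia.
- lia.
- by move=> m s' [N [p [q [_ _ _ _]]]]; lia.
- move=> m s1 fr [N [p [q [lE qN P1 clos lt_m]]]].
  rewrite P1 ltz_nat => /last_into_gt0[p2 [g [q2 [qE gx lastE p2P]]]].
  have cntE : count (enters x) q = (count (enters x) q2).+1.
    rewrite qE count_cat /= [enters x g]/enters gx eqxx; suff -> : count (enters x) p2 = 0 by lia.
    by apply/eqP; rewrite -leqn0 leqNgt -has_count; apply/hasPn => h /p2P.
  rewrite lastE in P1; rewrite cntE in lt_m.
  have lE2 : l = (p ++ p2) ++ g :: q2 by rewrite lE qE catA.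
  have inv1 : arc_inv I l s1 by apply: arc_inv_frame inv; first exact: fr.
  case: fr => fr _ _.
  have {S}S : reg s1 rS = Posz (arc_lam f).+1 by rewrite fr.
  have {J}J : reg s1 rJ = Posz j by rewrite fr.
  have {One}One : reg s1 rOne = Posz 1 by rewrite fr.
  have tailE := arc_inv_tail inv1 lE2; have labE := arc_inv_lab inv1 lE2.
  have nextE := arc_inv_next inv1 lE2; rewrite gx in nextE.
  have clos2 N' : (arc_lam g <= arc_lam f -> g.1 \in D ++ N') ->
      {subset D ++ N <= D ++ N'} ->
      {in rcons (p ++ p2) g, forall h, h.2 = x -> arc_lam h <= arc_lam f -> h.1 \in D ++ N'}.
    move=> gN' NN' h; rewrite mem_rcons inE mem_cat => /or3P[/eqP -> _ //|hp hx le_h|/p2P].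
      by apply: NN'; apply: clos.
    by move=> /eqP.
  have lE3 : l = rcons (p ++ p2) g ++ q2 by rewrite cat_rcons.
  have [|m1 m1E ->] := @credits 12 m; first by lia.
  rewrite /scan_arc /=; wmem (rewrite P1); wmem (rewrite P1).
  rewrite tailE labE S One.
  have leE : (0 < Posz (arc_lam f).+1 - Posz (lam (ttc_graph I) [set g.1; g.2]).+1
                  + Posz 1)%R = (arc_lam g <= arc_lam f).
    by rewrite /arc_lam -/G; lia.
  apply: wp_ifI => /=; rewrite leE => le_g; last first.
    wmem (rewrite P1); rewrite nextE.
    exists N, (rcons (p ++ p2) g), q2; split=> //=.
    + exact: queue_inv_ext qN.
    + by apply: clos2 => // le_g'; rewrite le_g' in le_g.
    + by lia.
  wmem idtac; rewrite J.
  have qext := queue_inv_ext _ _ _ qN.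
  have mem_g : (0 < Posz j - arr s1 aMark (num g.1))%R = (g.1 \notin D ++ N).
    have [gD|/(queue_inv_notin qN)] := boolP (g.1 \in D ++ N).
      by rewrite (queue_inv_in qN gD); lia.
    by lia.
  apply: wp_ifI => /=; rewrite mem_g => gD; wsteps; last first.
    wmem (rewrite P1); rewrite nextE.
    exists N, (rcons (p ++ p2) g), q2; split=> //=.
    + exact: qext.
    + by apply: clos2 => // _; move: gD; rewrite negbK.
    + by lia.
  have CE := queue_inv_C qN.
  wmem idtac; wmem (rewrite CE); wmem (rewrite P1).
  rewrite nextE ?CE ?One ?J.
  have subN : {subset D ++ N <= D ++ rcons N g.1}.
    by move=> y; rewrite !mem_cat mem_rcons inE => /orP[] ->; rewrite ?orbT.
  exists (rcons N g.1), (rcons (p ++ p2) g), q2; split=> //=.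
  + rewrite -rcons_cat; case: qN => uN cell mark nmark _ reachN start; split=> /=.
    * by rewrite rcons_uniq gD.
    * move=> A y B; case: (lastP B) => [|B' z]; rewrite ?cats1.
        by move=> /rcons_inj[-> ->]; rewrite eqxx.
      rewrite -rcons_cons -rcons_cat => /rcons_inj[DNE _].
      by rewrite ifN ?(cell _ _ _ DNE) // DNE size_cat /=; lia.
    * move=> y; rewrite mem_rcons inE (inj_eq (@num_inj V)).
      by case: eqVneq => //= _; apply: mark.
    * move=> y; rewrite mem_rcons inE (inj_eq (@num_inj V)).
      by case: eqVneq => //= _; apply: nmark.
    * by rewrite size_rcons -PoszD addn1.
    * move=> y; rewrite mem_rcons inE => /orP[/eqP ->|/reachN //].
      rewrite /reaches; apply: connect_trans xf; apply: connect1.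
      rewrite /upto -[x in [set g.1; x]]gx -gx -surjective_pairing lF ?andbT //.
      by rewrite lE2 mem_cat inE eqxx orbT.
    * by rewrite mem_rcons inE start orbT.
  + by apply: clos2 => // _; rewrite mem_cat mem_rcons inE eqxx orbT.
  + by rewrite size_rcons; lia.
- move=> m s' _ [N [p [q [lE qN P1 clos lt_m]]]].
  rewrite P1 ltz_nat -eqn0Ngt => /eqP q0; exists N; split=> //; last by lia.
  move=> g; rewrite lE mem_cat => /orP[|/(last_into_eq0 q0)/eqP //]; exact: clos.
Qed.

Record search_post (f : V * V) (j : nat) (l : seq (V * V)) (D : seq V) (s : state) : Prop :=
  SearchPost {
  search_post_uniq : uniq D;
  search_post_mem : forall x, (x \in D) = reaches G F x f;
  search_post_size : size D <= (size l).+1;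
  search_post_cell : forall A x B, D = A ++ x :: B ->
    arr s aQueue (size A) = Posz (num x);
  search_post_mark : forall x : V, (arr s aMark (num x) < Posz j.+1)%R;
  search_post_C : reg s rC = Posz (size D)
}.

Lemma search_ok (f : V * V) (l : seq (V * V)) j k s :
  l =i F -> arc_inv I l s -> reg s rS = Posz (arc_lam f).+1 ->
  reg s rJ = Posz j -> reg s rOne = Posz 1 -> reg s rA = Posz (num f.1) ->
  (forall x : V, arr s aMark (num x) < Posz j)%R ->
  wp search (fun m s' => k <= m /\ exists D, search_post f j l D s')
    (k + 25 * size l + 20) s.
Proof.
move=> lF inv S J One A mark0.
have [|m m1E ->] := @credits 6 (k + 25 * size l + 20); first by lia.
rewrite /search /=; wmem (rewrite A); wmem idtac; rewrite J A One.
set s0 := setr _ _ _.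
have inv0 : arc_inv I l s0 by case: inv; split.
have S0 : reg s0 rS = Posz (arc_lam f).+1 by [].
have J0 : reg s0 rJ = Posz j by [].
have One0 : reg s0 rOne = Posz 1 by [].
(* [D1] is expanded and [D2] waits. The allowed predecessors of [D1] are in the queue, so [D1] is
   closed once [D2] is empty. The potential is 10 per waiting vertex plus 25 per arc into a vertex
   outside [D1]. *)
apply: (@wp_while_frame (fun m s' => exists D1 D2,
  [/\ queue_inv f j (D1 ++ D2) s', reg s' rH = Posz (size D1),
      reg s' rL = Posz (size D2),
      {in l, forall g, g.2 \in D1 -> arc_lam g <= arc_lam f -> g.1 \in D1 ++ D2}
      & k + 10 * size D2 + 25 * count (enters_none D1) l < m])).
- exists [::], [:: f.1]; split=> //=; last by have := count_size (enters_none [::]) l; lia.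
  split=> //=.
  + by move=> [|? []] x B //= [-> _].
  + by move=> x; rewrite inE => /eqP ->; rewrite eqxx.
  + by move=> x; rewrite inE (inj_eq (@num_inj V)) => /negbTE ->.
  + by move=> x; rewrite inE => /eqP ->; apply: connect0.
  + by rewrite inE.
- by [].
- by move=> m2 s' [D1 [D2 [_ _ _ _]]]; lia.
- move=> m2 s1 fr [D1 [[|x D2] [qD H L clos lt_m]]]; first by rewrite L.
  move=> _; have [|m3 m3E ->] := @credits 3 m2; first by move: lt_m => /=; lia.
  have xD : x \in D1 ++ x :: D2 by rewrite mem_cat inE eqxx orbT.
  have xD1 : x \notin D1.
    have := queue_inv_uniq qD; rewrite cat_uniq => /and3P[_ /hasPn/(_ x) + _].
    by rewrite inE eqxx => /(_ isT).
  have inv1 : arc_inv I l s1 by apply: arc_inv_frame inv0; first exact: fr.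
  have qE := queue_inv_cell qD (erefl _).
  case: fr => fr _ _.
  rewrite /expand /=; wmem (rewrite H); wmem (rewrite qE).
  set s2 := setr _ _ _.
  have [k' k'E] : exists k', m3 = k' + 25 * count (enters x) l + 2.
    exists (m3 - (25 * count (enters x) l + 2)).
    by move: lt_m; rewrite (count_enters_none _ xD1) /=; lia.
  rewrite k'E; apply: (wp_use (@scan_ok f l j (D1 ++ x :: D2) x k' s2 _ _ _ _ _ _ _ _)).
  + by move=> g; rewrite lF.
  + by case: inv1.
  + by rewrite /= fr.
  + by rewrite /= fr.
  + by rewrite /= fr.
  + exact: (queue_inv_reach qD xD).
  + exact: queue_inv_ext qD.
  + by rewrite /= (arc_inv_first inv1).
  move=> m4 s4 [N [qN closN lt_m4]] [fr4 _ _].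
  have [|m5 m5E ->] := @credits 1 m4.
    by move: lt_m k'E; rewrite (count_enters_none _ xD1) /=; lia.
  wsteps.
  exists (rcons D1 x), (D2 ++ N); split=> /=.
  + by rewrite cat_rcons -cat_cons catA; apply: queue_inv_ext qN.
  + by rewrite fr4 //= H (fr rOne isT) One0 -PoszD size_rcons addn1.
  + by rewrite (queue_inv_C qN) fr4 //= H (fr rOne isT) One0 -PoszD !size_cat /=; lia.
  + move=> g gl; rewrite mem_rcons inE cat_rcons -cat_cons catA => /orP[/eqP gx|gD] le_g.
      exact: closN.
    by rewrite mem_cat; apply/orP; left; apply: clos.
  + by move: lt_m lt_m4 k'E; rewrite (count_enters_none _ xD1) size_cat /=; lia.
- move=> m2 s1 _ [D1 [D2 [qD H L clos lt_m]]].
  rewrite L ltz_nat -eqn0Ngt size_eq0 => /eqP D20; subst D2; rewrite cats0 in qD clos.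
  split; first by lia.
  have [uD cell mark nmark CE reachD start] := qD.
  have memD x : (x \in D1) = reaches G F x f.
    apply/idP/idP; first exact: reachD.
    case/connectP => p; elim: p x => [|y p IH] x /=; first by move=> _ <-.
    move=> /andP[/andP[xy le_xy] yp] /(IH _ yp) yD.
    by apply: (clos (x, y)); rewrite ?lF.
  exists D1; split=> //.
    (* Apart from [f.1], every vertex found is the tail of an arc. *)
    rewrite -(size_map fst l) -[(size _).+1]/(size (f.1 :: map fst l)).
    apply: uniq_leq_size => // x; rewrite memD inE.
    case/connectP => [[|y p]] /=; first by move=> _ <-; rewrite eqxx.
    by move=> /andP[/andP[xy _] _] _; apply/orP; right; apply/mapP; exists (x, y); rewrite ?lF.
  move=> x; have [/mark ->|/nmark] := boolP (x \in D1); lia.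
Qed.

End Search.

(** * Counting forced pairs and detecting violations *)

Section Processing.

Variables (V : finType) (I : ttc_instance V).

Let G := ttc_graph I.
Let F := ttc_orient I.

(** [T] holds the owners of rows; all other vertices share the offset 0, so injectivity is confined
    to [T]. *)
Record rows (T : pred V) (off : V -> nat) (s : state) : Prop := Rows {
  rows_off : forall v, arr s aOff (num v) = Posz (off v);
  rows_inj : forall u u' w w' : V, T u -> T u' ->
    off u + num w = off u' + num w' -> (u, w) = (u', w')
}.

Lemma rows_frame T off c s s' : frame c s s' -> aOff \notin warrs c ->
  rows T off s -> rows T off s'.
Proof. by move=> [_ fa _] k1 [offE inj]; split=> // v; rewrite fa. Qed.

Definition matrix_inv (T : pred V) (off : V -> nat) (S : {set V * V}) (s : state) : Prop :=
  forall u w : V, T u -> arr s aMat (off u + num w) =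
    if [set u; w] \in edges G then Posz (lam G [set u; w]).+1
    else if (u, w) \in S then (- 1)%R else 0%R.

(** The extra 1 turns [#|S| <= k] into positivity of [rK]. After a violation only the sign is known,
    since decrements continue. *)
Definition budget_inv (S : {set V * V}) (bad : bool) (s : state) : Prop :=
  if bad then is_true (reg s rK <= 0)%R
  else reg s rK = (ttc_budget I + 1 - Posz #|S|)%R.

Lemma visit_cell_ok (f : V * V) (T : pred V) (off : V -> nat) (S : {set V * V}) bad x k s :
  rows T off s -> T x -> reg s rX = Posz (num x) -> reg s rB = Posz (num f.2) ->
  reg s rS = Posz (arc_lam I f).+1 -> reg s rOne = Posz 1 ->
  matrix_inv T off S s -> budget_inv S bad s ->
  wp visit_cell (fun m s' => let S' := if [set x; f.2] \in edges G then S else (x, f.2) |: S in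
     [/\ matrix_inv T off S' s',
         budget_inv S' (bad || ([set x; f.2] \in edges G) && (lam G [set x; f.2] < arc_lam I f)) s'
       & k <= m]) (k + 10) s.
Proof.
move=> [offE cell] Tx X B S1 One mat bud.
have [|m mE ->] := @credits 10 (k + 10); first by lia.
rewrite /visit_cell /=; wmem (rewrite X); wmem (rewrite offE B -PoszD); rewrite mat //.
case: ifP => xw.
  apply: wp_ifI => //= _; wsteps; rewrite S1.
  have cond : (0 < Posz (arc_lam I f).+1 - Posz (lam G [set x; f.2]).+1)%R =
      (lam G [set x; f.2] < arc_lam I f) by lia.
  apply: wp_ifI => /=; rewrite cond => lt_f; wsteps; split=> //; try lia.
  - by rewrite lt_f /= orbT /budget_inv.
  - by rewrite (negbTE lt_f) orbF.
rewrite orbF; case: ifP => xwS; apply: wp_ifI => //= _; wsteps; rewrite One; apply: wp_ifI => //= _.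
  (* A pair that is already counted is not charged again. *)
  have -> : (x, f.2) |: S = S by apply/setUidPr; rewrite sub1set.
  by wsteps; split=> //; lia.
wmem (rewrite offE B -PoszD); split; last lia.
- move=> u w Tu /=; case: eqP => [/(cell _ _ _ _ Tu Tx)[-> ->]|ne].
    by rewrite xw !inE eqxx.
  rewrite mat // !inE; case: eqP => [[uE wE]|] //; by case: ne; rewrite uE wE.
- rewrite /budget_inv /= ?One; case: bad bud; rewrite /budget_inv; first lia.
  by rewrite cardsU1 xwS => ->; lia.
Qed.

Definition adds (f : V * V) (D : seq V) (S S' : {set V * V}) : Prop :=
  forall x w, ((x, w) \in S') =
    ((x, w) \in S) || [&& w == f.2, x \in D & [set x; w] \notin edges G].

Lemma visits_ok (f : V * V) (T : pred V) (off : V -> nat) (S : {set V * V}) bad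
    (D : seq V) k s :
  rows T off s -> {in D, forall x, T x} ->
  (forall A x B, D = A ++ x :: B -> arr s aQueue (size A) = Posz (num x)) ->
  reg s rC = Posz (size D) -> reg s rB = Posz (num f.2) ->
  reg s rS = Posz (arc_lam I f).+1 -> reg s rOne = Posz 1 ->
  matrix_inv T off S s -> budget_inv S bad s ->
  wp visits (fun m s' => exists S',
    [/\ adds f D S S', matrix_inv T off S' s',
        budget_inv S' (bad || has (violates G ^~ f) D) s' & k <= m])
    (k + 20 * size D + 2) s.
Proof.
move=> rowsT DT cells C B S1 One mat bud.
apply: (@wp_while_frame (fun m s' => exists A B S',
  [/\ D = A ++ B /\ reg s' rC = Posz (size A),
    adds f B S S',
        matrix_inv T off S' s', budget_inv S' (bad || has (violates G ^~ f) B) s'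
      & k + 20 * size A < m])).
- exists D, [::], S; rewrite cats0; split=> //=; last lia.
  + by move=> x w; rewrite andbF orbF.
  + by rewrite orbF.
- lia.
- by move=> m s' [A [B' [S' [_ _ _ _]]]]; lia.
- move=> m s1 fr [A [B' [S' [[DE C1] S'E mat1 bud1 lt_m]]]].
  case: (lastP A) DE C1 lt_m => [|A' x] DE C1 lt_m; first by rewrite C1.
  move=> _; rewrite size_rcons in C1 lt_m.
  have rows1 := rows_frame fr isT rowsT.
  case: fr => fr fa _.
  have One1 : reg s1 rOne = Posz 1 by rewrite fr.
  have B1 : reg s1 rB = Posz (num f.2) by rewrite fr.
  have S11 : reg s1 rS = Posz (arc_lam I f).+1 by rewrite fr.
  have subE : (Posz (size A').+1 - Posz 1)%R = Posz (size A') by lia.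
  have qE : arr s1 aQueue (size A') = Posz (num x).
    by rewrite fa // (cells A' x B') // DE cat_rcons.
  have Tx : T x by apply: DT; rewrite DE mem_cat mem_rcons inE eqxx.
  have [|m1 m1E ->] := @credits 7 m; first by lia.
  (* The three outcomes of comparing [x] with [f.2] all continue with [visit_cell]; only the
     violation flag differs. *)
  have cellP bad2 s2 n2 :
      rows T off s2 -> matrix_inv T off S' s2 -> reg s2 rC = Posz (size A') ->
      reg s2 rX = Posz (num x) -> reg s2 rB = Posz (num f.2) ->
      reg s2 rS = Posz (arc_lam I f).+1 -> reg s2 rOne = Posz 1 ->
      bad2 = bad || has (violates G ^~ f) B' || (x == f.2) -> budget_inv S' bad2 s2 ->
      m1 <= n2 ->
      wp visit_cell (fun m s' => exists A B S',
        [/\ D = A ++ B /\ reg s' rC = Posz (size A),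
          adds f B S S',
          matrix_inv T off S' s', budget_inv S' (bad || has (violates G ^~ f) B) s'
        & k + 20 * size A < m]) n2 s2.
    move=> rows2 mat2 C2 X2 B2 S2 One2 bad2E bud2 le_n2.
    have -> : n2 = (n2 - 10) + 10 by lia.
    apply: (wp_use (@visit_cell_ok f T off S' bad2 x _ s2 rows2 Tx X2 B2 S2 One2 mat2 bud2)).
    move=> m3 s3 [mat3 bud3 le_m3] [fr3 _ _].
    eexists A', (x :: B'), _; split; [|..|exact: mat3| |].
    + by rewrite DE cat_rcons fr3.
    + move=> y w; rewrite inE; case: ifP => xw; rewrite ?inE S'E ?xpair_eqE.
        case: (w =P f.2) => [->|_] //=; case: (y =P x) => [->|_] //=.
        by rewrite xw !andbF.
      case: (w =P f.2) => [->|_]; rewrite ?andbF //=; case: (y =P x) => [->|_] //=.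
      by rewrite xw orbT.
    + by move: bud3; rewrite bad2E /= /violates -!orbA; congr (budget_inv _ _ _); do !bool_congr.
    + by lia.
  rewrite /visit /=; wsteps; wmem (rewrite C1 One1 subE); rewrite qE B1.
  have neq_num y z : num y <> num z -> (y == z :> V) = false.
    by move=> ne; apply/eqP => yz; apply: ne; rewrite yz.
  have cond a b : (0 < Posz a - Posz b)%R = (b < a) by lia.
  apply: wp_ifI => /=; rewrite cond => lt1; wsteps.
    apply: cellP; rewrite /= ?C1 ?One1 ?subE //; [by case: rows1| |lia].
    by rewrite neq_num ?orbF; [|lia].
  apply: wp_ifI => /=; rewrite cond => lt2; wsteps.
    apply: cellP; rewrite /= ?C1 ?One1 ?subE //; [by case: rows1|].
    by rewrite neq_num ?orbF; [|lia].
  apply: cellP; rewrite /= ?C1 ?One1 ?subE //; [by case: rows1|].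
  have -> : x = f.2 by apply: (@num_inj V); lia.
  by rewrite eqxx orbT.
- move=> m s1 _ [A [B' [S' [[DE C1] S'E mat1 bud1 lt_m]]]].
  rewrite C1 ltz_nat -eqn0Ngt size_eq0 => /eqP A0; subst A.
  by rewrite cat0s in DE; subst B'; exists S'; split=> //; lia.
Qed.

Definition visited (q : seq (V * V)) (S : {set V * V}) : Prop :=
  forall x w, ((x, w) \in S) =
    ([set x; w] \notin edges G) && has (fun f => (f.2 == w) && reaches G F x f) q.

Definition bad_arc (f : V * V) : bool := [exists x, reaches G F x f && violates G x f].

(** Per arc, the search takes 25 |l| + 20 credits, its visits at most 20 (|l| + 1) + 2 and the rest
    6, within 45 |l| + 60. *)
Lemma process_arcs_ok (l : seq (V * V)) (T : pred V) (off : V -> nat) k s :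
  l =i F -> {in l, forall g, T g.1} -> arc_inv I l s -> rows T off s ->
  matrix_inv T off set0 s -> budget_inv set0 false s ->
  reg s rI = Posz (size l) -> reg s rJ = Posz 0 -> reg s rOne = Posz 1 ->
  (forall x, arr s aMark x = Posz 0) ->
  wp process_arcs (fun m s' => exists S, [/\ visited l S,
      budget_inv S (has bad_arc l) s' & k <= m])
    (k + (45 * size l + 60) * size l + 2) s.
Proof.
move=> lF lT inv rowsT mat bud Ic J One mark0.
(* Arcs are numbered from the end of [l], so the processed ones form the suffix [q], and the next
   one has number and stamp [(size q).+1], above all marks. *)
apply: (@wp_while_frame (fun m s' => exists p q S,
  [/\ l = p ++ q /\ reg s' rI = Posz (size p), reg s' rJ = Posz (size q),
      (forall x : V, arr s' aMark (num x) < Posz (size q).+1)%R,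
      [/\ visited q S, matrix_inv T off S s' & budget_inv S (has bad_arc q) s']
    & k + (45 * size l + 60) * size p < m])).
- exists l, [::], set0; rewrite cats0; split=> //=; last lia.
    by move=> x; rewrite mark0.
  by split=> // x w; rewrite inE andbF.
- lia.
- by move=> m s' [p [q [S [_ _ _ _]]]]; lia.
- move=> m s1 fr [p [q [S [[lE I1] J1 mark1 [vis1 mat1 bud1] lt_m]]]].
  case: (lastP p) lE I1 lt_m => [|p' f] lE I1 lt_m; first by rewrite I1.
  move=> _; rewrite size_rcons in I1 lt_m; rewrite cat_rcons in lE.
  have rows1 := rows_frame fr isT rowsT.
  have inv1 : arc_inv I l s1 by apply: arc_inv_frame inv; first exact: fr.
  case: fr => fr _ _.
  have One1 : reg s1 rOne = Posz 1 by rewrite fr.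
  have jE : (Posz (size q) + Posz 1)%R = Posz (size q).+1 by rewrite -PoszD addn1.
  have Tf : T f.1 by apply: lT; rewrite lE mem_cat inE eqxx orbT.
  have [|m1 m1E ->] := @credits 4 m; first by move: lt_m; rewrite mulnS; lia.
  rewrite /process_arc /=; wmem (rewrite J1 One1 jE); wmem (rewrite J1 One1 jE).
  wmem (rewrite J1 One1 jE).
  rewrite J1 One1 jE (arc_inv_tail inv1 lE) (arc_inv_head inv1 lE) (arc_inv_lab inv1 lE).
  set s2 := setr _ _ _.
  have [k1 k1E] : exists k1, m1 = k1 + 25 * size l + 20.
    by exists (m1 - (25 * size l + 20)); move: lt_m; rewrite mulnS; lia.
  have inv2 : arc_inv I l s2 by case: inv1; split.
  rewrite k1E.
  apply: (wp_use (@search_ok _ I f l (size q).+1 k1 s2 lF inv2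
    (erefl _) (erefl _) One1 (erefl _) mark1)).
  move=> m3 s3 [le_m3 [D [uD memD szD cells mark3 C3]]] fr3.
  have rows2 : rows T off s2 by case: rows1.
  have rows3 := rows_frame fr3 isT rows2.
  case: fr3 => fr3 fa3 _.
  have [k2 k2E] : exists k2, m3 = k2 + 20 * size D + 2.
    by exists (m3 - (20 * size D + 2)); move: lt_m; rewrite mulnS; lia.
  wstep; rewrite k2E.
  have DT : {in D, forall x, T x}.
    move=> x; rewrite memD => /connectP[[|y r]] /=; first by move=> _ <-.
    by move=> /andP[/andP[xy _] _] _; apply: (lT (x, y)); rewrite lF.
  have mat3 : matrix_inv T off S s3 by move=> u w Tu; rewrite fa3 //; apply: mat1.
  have bud3 : budget_inv S (has bad_arc q) s3 by rewrite /budget_inv fr3.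
  have B3 : reg s3 rB = Posz (num f.2) by rewrite fr3.
  have S3 : reg s3 rS = Posz (arc_lam I f).+1 by rewrite fr3.
  have One3 : reg s3 rOne = Posz 1 by rewrite fr3.
  apply: (wp_use (@visits_ok f T off S _ D k2 s3 rows3 DT cells C3 B3 S3 One3 mat3 bud3)).
  move=> m4 s4 [S' [S'E mat4 bud4 le_m4]] [fr4 fa4 _].
  have [|m5 m5E ->] := @credits 1 m4; first by move: lt_m; rewrite mulnS; lia.
  wsteps.
  exists p', (f :: q), S'; split=> /=.
  + by rewrite fr4 // fr3 //= I1 fr4 // fr3 //= One1; split=> //; lia.
  + by rewrite fr4 // fr3.
  + by move=> x; rewrite fa4 //; apply: mark3.
  + split=> //.
      move=> x w; rewrite S'E vis1 /= memD andbC -/G (eq_sym w).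
      by case: ([set x; w] \in edges G); rewrite /= ?andbF ?andbT // orbC.
    have -> : bad_arc f = has (violates G ^~ f) D; last by rewrite orbC; exact: bud4.
    apply/existsP/hasP => [[x /andP[xf vx]]|[x xD vx]]; exists x => //.
      by rewrite memD.
    by rewrite -memD xD.
  + by move: lt_m; rewrite mulnS; lia.
- move=> m s1 _ [p [q [S [[lE I1] J1 mark1 [vis1 mat1 bud1] lt_m]]]].
  rewrite I1 ltz_nat -eqn0Ngt size_eq0 => /eqP p0; subst p.
  by rewrite cat0s in lE; subst q; exists S; split=> //; lia.
Qed.

Lemma encodes_size (es : seq (V * V)) :
  perm_eq [seq [set e.1; e.2] | e <- es] (enum (edges G)) -> size es = #|edges G|.
Proof. by move=> /perm_size; rewrite size_map -cardE. Qed.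

(** Turns bounds in the number of arcs into bounds in m. *)
Lemma card_orientation : proper_orientation (edges G) F -> #|F| <= #|edges G|.
Proof.
move=> FP; rewrite -(card_in_imset (f := fun p => [set p.1; p.2])).
  apply/subset_leq_card/subsetP => e /imsetP[[u v] uv ->]; exact: FP.1.
move=> [a b] [c d] ab cd /set2_inj[-> //|eq_p].
by have := FP.2 _ _ (FP.1 _ _ cd); rewrite cd; move: ab; rewrite eq_p => ->.
Qed.

Definition word_code (es fs : seq (V * V)) : seq int :=
  [:: Posz #|V|; Posz #|edges G|; Posz #|F|; ttc_budget I]
    ++ edge_words I es ++ arc_words fs.

Lemma ttc_cmd_ok (es fs : seq (V * V)) :
  proper_orientation (edges G) F ->
  perm_eq [seq [set e.1; e.2] | e <- es] (enum (edges G)) -> perm_eq fs (enum F) ->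
  wp ttc_cmd (fun _ s => (0 < reg s rK)%R <-> TTC I) (100 * (#|edges G|).+1 ^ 2)
    (State (fun=> 0%R) (fun _ _ => 0%R) (word_code es fs)).
Proof.
move=> FP esE fsE; have sz_es := encodes_size esE.
have sz_fs : size fs = #|F| by rewrite (perm_size fsE) -cardE.
have fsF g : (g \in fs) = (g \in F) by rewrite (perm_mem fsE) mem_enum.
have esG e : (e \in [seq [set e.1; e.2] | e <- es]) = (e \in edges G).
  by rewrite (perm_mem esE) mem_enum.
have le_F := card_orientation FP.
set m := #|edges G|.
have [|n nE ->] := @credits 6 (100 * m.+1 ^ 2); first by nia.
rewrite /ttc_cmd /word_code /=; wsteps; set s1 := setr _ _ _.
(* With 6 credits for the header, the phases need at most 45 m^2 + 110 m + 12 in all. *)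
pose k3 := ((45 * size fs + 60) * size fs + 2); pose k2 := k3 + 20 * size fs + 2.
have [d nE2] : exists d, n = d + (k2 + 30 * size es + 2).
  exists (n - (k2 + 30 * size es + 2)); move: nE le_F; rewrite /k2 /k3 sz_fs sz_es -/m; nia.
have -> : n = (d + k2) + 30 * size es + 2 by lia.
have M1 : reg s1 rM = Posz (size es) by rewrite sz_es.
apply: (wp_use (@read_edges_ok V I es (arc_words fs) (d + k2) s1 (erefl _) M1
  (erefl _) (erefl _) (erefl _) (fun=> erefl _) (fun=> erefl _))).
move=> m2 s2 [le_m2 inp2 [D [q [cnt inv2]]]] [fr2 fa2 _].
pose T : pred V := fun u => u \in D; pose off u := #|V| * q u.
have endpT g : g \in F -> T g.1.
  move=> gF; have : [set g.1; g.2] \in [seq [set e.1; e.2] | e <- es].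
    by rewrite esG; apply: FP.1; rewrite -surjective_pairing.
  by case/mapP => e /(edge_inv_sub inv2)[e1 e2] /set2_inj[] [-> _].
have labE u w : label I es u w =
    if [set u; w] \in edges G then (lam G [set u; w]).+1 else 0.
  by rewrite /label esG.
wstep; have -> : m2 = (m2 - (20 * size fs + 2)) + 20 * size fs + 2 by rewrite /k2 in le_m2; lia.
have F2 : reg s2 rF = Posz (size fs) by rewrite fr2 //= sz_fs.
have mat2 : {in fs, forall f, arr s2 aMat (off f.1 + num f.2) = Posz (lam G [set f.1; f.2]).+1}.
  move=> g; rewrite fsF => gF; rewrite (edge_inv_mat inv2) ?labE; last exact: endpT.
  by rewrite FP.1 // -surjective_pairing.
have inp2' : inp s2 = arc_words fs ++ [::] by rewrite cats0.
apply: (wp_use (@read_arcs_ok V I off fs [::] _ s2 F2 _ _ inp2' _ (edge_inv_off inv2) mat2)).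
- by rewrite fr2.
- by rewrite fr2.
- by move=> x; rewrite fa2.
move=> m3 s3 [le_m3 I3 inv3] [fr3 fa3 _].
have -> : m3 = (m3 - k3) + (45 * size (rev fs) + 60) * size (rev fs) + 2.
  by rewrite size_rev; move: le_m3 le_m2; rewrite /k2 /k3; lia.
apply: (wp_use (@process_arcs_ok (rev fs) T off _ s3 _ _ inv3 _ _ _ _ _ _ _)).
- by move=> g; rewrite mem_rev fsF.
- by move=> g; rewrite mem_rev fsF; apply: endpT.
- split=> [v|u u' w w' Tu Tu' eq_c]; first by rewrite fa3 // (edge_inv_off inv2).
  have [eq_q eq_w] := cell_inj (num_lt w) (num_lt w') eq_c.
  by rewrite (edge_inv_inj inv2 Tu eq_q) (num_inj eq_w).
- move=> u w Tu; rewrite fa3 // (edge_inv_mat inv2) // labE inE.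
  by case: ifP.
- by rewrite /budget_inv fr3 // fr2 //= cards0 subr0.
- by rewrite size_rev.
- by rewrite fr3 // fr2.
- by rewrite fr3 // fr2.
- by move=> x; rewrite fa3 // fa2.
move=> m4 s4 [S [visS budS _]] _; rewrite (TTC_iff FP) -/G -/F.
have SE : S = new_pairs G F.
  apply/setP => -[x w]; rewrite visS !inE /= andbC; congr (_ && _).
  apply/hasP/exists_inP => -[g]; rewrite ?mem_rev ?fsF => gF gP; exists g => //.
  by rewrite mem_rev fsF.
have badE : has bad_arc (rev fs) = false <-> consistent G F.
  split=> [/hasPn bad x g gF xg|cons].
    apply/negP => vx; have := bad g; rewrite mem_rev fsF gF => /(_ isT)/negP[]; apply/existsP.
    by exists x; rewrite xg.
  apply/hasPn => g; rewrite mem_rev fsF => gF; apply/existsP => -[x /andP[xg]].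
  by apply/negP; apply: cons.
move: budS; rewrite /budget_inv SE -badE; case: (has _ _) => [le0|->].
  by split=> [|[]]; lia.
by split=> [|[_]]; first (move=> ?; split=> //); lia.
Qed.

End Processing.

Theorem theorem4p2 :
  exists (p : program) (T : nat -> nat),
    bigO T (fun m => m ^ 2) /\
    forall (V : finType) (I : ttc_instance V) (w : seq int),
      proper_orientation (edges (ttc_graph I)) (ttc_orient I) ->
      encodes I w ->
      exists b : bool,
        run p (T #|edges (ttc_graph I)|) (init w) = Some b /\
        (b <-> TTC I).
Proof.
exists (decider ttc_cmd rK), (fun m => 10 * (100 * m.+1 ^ 2) + 2); split.
  (* For m at least 1, (m + 1)^2 is at most 4 m^2 and the additive 2 at most 2 m^2. *)
  by exists 4002, 1 => m m1; rewrite -!mulnn; nia.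
move=> V I w FP [es [fs [esE fsE ->]]].
have dec := @wp_decider ttc_cmd rK _ _ (TTC I) isT (ttc_cmd_ok FP esE fsE).
exact: dec.
Qed.
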